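(* Let $(H,e)$ be a unital Hilbert space, let $\mathfrak B^e_h$ be the quantum set with $\mathfrak B^e_h\cap M_m(H)=\{\eta\in M_m(H)_h:\langle\langle\eta,\bar e\rangle\rangle=0,\ \|\eta\|_o\le1\}$, and define quantum cones $\mathfrak C_o$ on $H$ and $\overline{\mathfrak C_o}$ on $\overline H$ by $\mathfrak C_o\cap M_n(H)=\{\zeta\in M_n(H)_h:\langle\langle\zeta,\bar\eta+\bar e^{(m)}\rangle\rangle\ge0\ \forall m,\ \forall\eta\in\mathfrak B^e_h\cap M_m(H)\}$, $\overline{\mathfrak C_o}\cap M_n(\overline H)=\{\bar\xi\in M_n(\overline H)_h:\langle\langle\eta+e^{(m)},\bar\xi\rangle\rangle\ge0\ \forall m,\ \forall\eta\in\mathfrak B^e_h\cap M_m(H)\}$. Then $\mathfrak C_o$ is a separated, unital quantum cone on $H$ with $\mathfrak C_o\cap M_1(H)=\mathfrak c_e$, so that $(H,(\mathfrak C_o\cap M_n(H))_n,e)$ is an operator system (Archimedean matrix-ordered $*$-vector space with matrix order unit $e$); its order-unit matrix norm equals $\|\cdot\|_e$ of Lemma lBP2 and is therefore equivalent to the operator Hilbert space norm $\|\cdot\|_o$. Its matricial state space $\{\bar\xi\in\mathfrak C_o^\boxdot:\langle\langle e,\bar\xi\rangle\rangle=I\}$ equals $\{\bar\eta+\bar e^{(n)}:\eta\in\mathfrak B^e_h\cap M_n(H),\ n\ge1\}$. Moreover $H_o$ is self-dual: $\mathfrak C_o^\boxdot=\overline{\mathfrak C_o}$ and $\overline{\mathfrak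 C_o}^\boxdot=\mathfrak C_o$.
   Context: A Hilbert $*$-space is a complex Hilbert space $H$ (inner product linear in the first variable) with a conjugate-linear $\zeta\mapsto\zeta^*$, $\zeta^{**}=\zeta$, $(\zeta^*,\eta^* )=\overline{(\zeta,\eta)}$. A unital Hilbert space $(H,e)$ has a fixed hermitian unit vector $e$; its unital cone is $\mathfrak c_e=\{\zeta\in H_h:\|\zeta\|\le\sqrt2(\zeta,e)\}$. $\overline H$ is the conjugate Hilbert space (vectors $\bar\eta$, involution $\bar\eta^*=\overline{\eta^*}$). Matrices over $H$ or $\overline H$ carry the involution $[x_{ij}]^*=[x_{ji}^*]$; for $\eta=[\eta_{ij}]$, $\bar\eta=[\overline{\eta_{ij}}]$; $e^{(m)}=\mathrm{diag}(e,\ldots,e)$. Matrix pairing: $\langle\langle\zeta,\bar\eta\rangle\rangle=[(\zeta_{ik},\eta_{jl})]_{(i,j),(k,l)}\in M_{nm}$ for $\zeta\in M_n(H)$, $\eta\in M_m(H)$; $\langle\langle\eta,\bar e\rangle\rangle=[(\eta_{ij},e)]$. $\|\zeta\|_o=\|\langle\langle\zeta,\bar\zeta\rangle\rangle\|^{1/2}$ is the operator Hilbert space matrix norm. Quantum polar: for a family $\mathfrak M$ of matrices over $H$, $\mathfrak M^\boxdot=\{\bar\xi\in M_n(\overline H)_h:\langle\langle\zeta,\bar\xi\rangle\rangle\ge0\ \forall\zeta\in\mathfrak M\}$, and symmetrically for families over $\overline H$. A quantum cone $\mathfrak C=(\mathfrak C_n)$: $\mathfrak C_n\subseteq M_n(H)_h$,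 $\mathfrak C_n+\mathfrak C_n\subseteq\mathfrak C_n$, $a^*\mathfrak C_na\subseteq\mathfrak C_m$ for $a\in M_{n,m}$; separated: $\mathfrak C_n\cap-\mathfrak C_n=\{0\}$; unital: for each $x\in M_n(H)_h$ some $x+re^{(n)}\in\mathfrak C_n$, $r>0$. Lemma lBP2: $\|\zeta\|_e=\sup\{\|\langle\langle\zeta,\bar\eta+\bar e^{(m)}\rangle\rangle\|:\eta\in\mathfrak B^e_h\cap M_m(H)\}$ satisfies $\frac12\|\zeta\|_e\le\|\zeta\|_o\le10\|\zeta\|_e$. *)

(* Defs.v *)
(* Scalars: a numClosedFieldType C whose real line is
   Dedekind complete (this pins C down to the complex numbers). *)
From HB Require Import structures.
From mathcomp Require Import all_boot all_order all_algebra.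
From Stdlib Require Import ClassicalEpsilon.
Set Implicit Arguments. Unset Strict Implicit. Unset Printing Implicit Defensive.
Import Order.TTheory GRing.Theory Num.Theory.
Local Open Scope ring_scope.

Definition is_lub (C : numClosedFieldType) (S : C -> Prop) (s : C) :=
  s \is Num.real /\ (forall x, S x -> x <= s) /\
  (forall b, b \is Num.real -> (forall x, S x -> x <= b) -> s <= b).
Definition is_glb (C : numClosedFieldType) (S : C -> Prop) (s : C) :=
  s \is Num.real /\ (forall x, S x -> s <= x) /\
  (forall b, b \is Num.real -> (forall x, S x -> b <= x) -> b <= s).

Definition complete_reals (C : numClosedFieldType) :=
  forall S : C -> Prop, (forall x, S x -> x \is Num.real) -> (exists x, S x) ->
  (exists b, b \is Num.real /\ forall x, S x -> x <= b) -> exists s, is_lub S s.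

Definition csup (C : numClosedFieldType) (S : C -> Prop) : C :=
  epsilon (inhabits 0) (is_lub S).
Definition cinf (C : numClosedFieldType) (S : C -> Prop) : C :=
  epsilon (inhabits 0) (is_glb S).

Record hilbert_star (C : numClosedFieldType) (H : lmodType C) := HilbertStar {
  ip : H -> H -> C;
  star : H -> H;
  ip_linl : forall (a : C) (x y z : H), ip (a *: x + y) z = a * ip x z + ip y z;
  ip_conjsym : forall x y : H, ip y x = (ip x y)^*;
  ip_posdef : forall x : H, x != 0 -> 0 < ip x x;
  ip_complete : forall u : nat -> H,
    (forall eps : C, 0 < eps -> exists N, forall i j, (N <= i)%N -> (N <= j)%N ->
        ip (u i - u j) (u i - u j) < eps) ->
    exists l : H, forall eps : C, 0 < eps -> exists N, forall i, (N <= i)%N ->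
        ip (u i - l) (u i - l) < eps;
  star_semilin : forall (a : C) (x y : H), star (a *: x + y) = a^* *: star x + star y;
  star_invol : forall x : H, star (star x) = x;
  star_ip : forall x y : H, ip (star x) (star y) = (ip x y)^*
}.

Section Defs.
Variables (C : numClosedFieldType) (H : lmodType C) (HS : hilbert_star H) (e : H).

Local Notation ip := (ip HS).
Local Notation star := (star HS).

Definition hnorm (x : H) : C := sqrtC (ip x x).

Definition unital_cone_e (x : H) : Prop :=
  star x = x /\ hnorm x <= sqrtC 2 * ip x e.

Definition mstar n m (x : 'M[H]_(n, m)) : 'M[H]_(m, n) := \matrix_(i, j) star (x j i).
Definition herm n (x : 'M[H]_n) : Prop := mstar x = x.
Definition emx n : 'M[H]_n := \matrix_(i, j) (if i == j then e else 0).
Definition scalemxH n (r : C) (x : 'M[H]_n) : 'M[H]_n := \matrix_(i, j) (r *: x i j).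
Definition congr_act n m (a : 'M[C]_(n, m)) (x : 'M[H]_n) : 'M[H]_m :=
  \matrix_(p, q) \sum_(i < n) \sum_(j < n) ((a i p)^* * a j q) *: x i j.

Definition unpair n m (p : 'I_(n * m)) : 'I_n * 'I_m :=
  enum_val (cast_ord (esym (@mxvec_cast n m)) p).

(* matrix pairing << zeta, bar xi >> in M_{nm}: entries (zeta_ik, xi_jl) at ((i,j),(k,l)).
   An element bar xi of M_m(bar H) is represented by xi in M_m(H). *)
Definition pairing n m (z : 'M[H]_n) (x : 'M[H]_m) : 'M[C]_(n * m) :=
  \matrix_(p, q) ip (z (unpair p).1 (unpair q).1) (x (unpair p).2 (unpair q).2).
Definition pair_e n (x : 'M[H]_n) : 'M[C]_n := \matrix_(i, j) ip (x i j) e.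
Definition e_pair n (x : 'M[H]_n) : 'M[C]_n := \matrix_(i, j) ip e (x i j).

Definition ctrans p q (v : 'M[C]_(p, q)) : 'M[C]_(q, p) := (map_mx Num.conj v)^T.
Definition psd k (M : 'M[C]_k) : Prop :=
  forall v : 'cV[C]_k, 0 <= (ctrans v *m M *m v) 0 0.
Definition vnorm k (v : 'cV[C]_k) : C := sqrtC ((ctrans v *m v) 0 0).
Definition opnorm p q (M : 'M[C]_(p, q)) : C :=
  csup (fun r => exists v : 'cV[C]_q, vnorm v <= 1 /\ r = vnorm (M *m v)).

Definition onorm n (z : 'M[H]_n) : C := sqrtC (opnorm (pairing z z)).

(* quantum families over H (and over bar H, represented through H) *)
Definition qfam := forall n : nat, 'M[H]_n -> Prop.

Definition Beh : qfam := fun m eta =>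
  herm eta /\ pair_e eta = 0 /\ onorm eta <= 1.

Definition Co : qfam := fun n z =>
  herm z /\ forall m (eta : 'M[H]_m), Beh eta -> psd (pairing z (eta + emx m)).
(* bar C_o : Cobar n xi  means  bar xi belongs to bar C_o *)
Definition Cobar : qfam := fun n x =>
  herm x /\ forall m (eta : 'M[H]_m), Beh eta -> psd (pairing (eta + emx m) x).

(* quantum polar of a family over H (result over bar H), and of a family over bar H *)
Definition qpolar (F : qfam) : qfam := fun m x =>
  herm x /\ forall n (z : 'M[H]_n), F n z -> psd (pairing z x).
Definition qpolar_bar (G : qfam) : qfam := fun n z =>
  herm z /\ forall m (x : 'M[H]_m), G m x -> psd (pairing z x).

Definition quantum_cone (F : qfam) : Prop :=
  (forall n x, F n x -> herm x) /\
  (forall n x y, F n x -> F n y -> F n (x + y)) /\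
  (forall n m (a : 'M[C]_(n, m)) x, F n x -> F m (congr_act a x)).
Definition separated (F : qfam) : Prop :=
  forall n x, F n x -> F n (- x) -> x = 0.
Definition unital (F : qfam) : Prop :=
  forall n (x : 'M[H]_n), herm x -> exists r : C, 0 < r /\ F n (x + scalemxH r (emx n)).
Definition archimedean (F : qfam) : Prop :=
  forall n (x : 'M[H]_n), (forall r : C, 0 < r -> F n (x + scalemxH r (emx n))) -> F n x.

Definition ounorm (F : qfam) n (x : 'M[H]_n) : C :=
  cinf (fun r => 0 < r /\
        F (n + n)%N (block_mx (scalemxH r (emx n)) x (mstar x) (scalemxH r (emx n)))).

Definition enorm n (z : 'M[H]_n) : C :=
  csup (fun r => exists m (eta : 'M[H]_m), Beh eta /\ r = opnorm (pairing z (eta + emx m))).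

End Defs.

(* Main.v *)
Require Import Defs.
From mathcomp Require Import all_boot all_order all_algebra.
From mathcomp Require Import ring.
From Stdlib Require Import ClassicalEpsilon.
Set Implicit Arguments. Unset Strict Implicit. Unset Printing Implicit Defensive.
Import Order.TTheory GRing.Theory Num.Theory.
Local Open Scope ring_scope.

(** Regard <<z, bar x>> as a sesquilinear form on the n x m complex matrices
    with their Hilbert-Schmidt norm.  Factoring test matrices as u = c d,
    v = a b with c c^*, d^* d, a a^*, b^* b of the same norms as u, v turns the
    ordinary Cauchy-Schwarz inequality for matrices over H into Haagerup's
    inequality ||<<z, bar x>>|| <= ||z||_o ||x||_o.  Testing a hermitian z
    against z / ||z||_o shows that this is sharp, so for <<z, e>> = r I one has
    z in C_o iff ||z - r e||_o <= r.  An arbitrary z in C_o becomes of this form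
    with r = 1 once a multiple of e is added and the inverse square root of
    <<z, e>> is applied by congruence; self-duality and the description of the
    matricial states follow.  The flip of the two tensor factors identifies
    the cone over bar H with C_o, and the order unit norm is compared with
    ||.||_e through the 2 x 2 block criterion for ||<<z, bar x>>|| <= r. *)

Local Notation "A ^h" := (ctrans A) (at level 8, format "A ^h").

(** * Complex matrices: Hilbert-Schmidt geometry, balanced factorization, whitening *)

Section ComplexMatrices.
Variable C : numClosedFieldType.
Implicit Types (x y c r s : C).

(** The order on [C] is partial, so x must first be seen to be real, as a difference of real
    numbers. Were it negative, r = -x/(2c) would leave the negative number x/2. This replaces every
    limit r -> 0 below. *)
Lemma ge0_of_perturbation x c : 0 <= c ->
  (forall r, 0 < r -> 0 <= x + r * c) -> 0 <= x.
Proof.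
rewrite le0r => /predU1P[-> /(_ 1 ltr01)|c_gt0 xP]; first by rewrite mulr0 addr0.
have x_real : x \is Num.real.
  rewrite -[x](addrK (1 * c)) realB // ger0_real ?xP ?mul1r ?ltW //.
case: (real_leP (real0 C) x_real) => // x_lt0.
have : 0 < - x / (2 * c) by rewrite divr_gt0 ?oppr_gt0 // mulr_gt0.
move/xP; have -> : x + - x / (2 * c) * c = x / 2.
  by field; rewrite gt_eqF //= pnatr_eq0.
by rewrite pmulr_lge0 ?invr_gt0 ?ltr0n // lt_geF.
Qed.

Lemma real_norm_le x r : x \is Num.real ->
  (`|x| <= r) = (0 <= x + r) && (0 <= r - x).
Proof.
move=> x_real; rewrite real_ler_norml // subr_ge0; congr (_ && _).
by rewrite -subr_ge0 opprK.
Qed.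

(** Discriminant criterion for the real quadratic x + 2 Re(tc) + |t|^2 y in a complex variable t. *)
Lemma discriminant_le (x y c : C) : 0 <= x -> 0 <= y ->
  (forall t, 0 <= x + t * c + (t * c)^* + t * t^* * y) -> `|c| ^+ 2 <= x * y.
Proof.
move=> x_ge0; rewrite le0r normCK => /predU1P[->|y_gt0] P.
  rewrite mulr0; have [->|c0] := eqVneq c 0; first by rewrite mul0r.
  have cc_gt0 : 0 < c * c^* by rewrite -normCK exprn_gt0 ?normr_gt0.
  (* With y = 0 the expression is affine in t; this t makes tc = -(x+1)/2, so that the value is
     -1. *)
  have := P (- (x + 1) / (2 * (c * c^*)) * c^*).
  rewrite mulr0 addr0 !rmorphM /= fmorphV !rmorphM rmorphN rmorphD /=.
  rewrite rmorph1 conjCK (CrealP (ger0_real x_ge0)) rmorph_nat.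
  have -> : x + - (x + 1) / (2 * (c * c^*)) * c^* * c
    + - (x + 1) / (2 * (c^* * c)) * c * c^* = - 1.
    by field; rewrite ?pnatr_eq0 conjC_eq0 c0.
  by rewrite oppr_ge0 ler10.
have y0 : y != 0 by rewrite gt_eqF.
(* The minimizer of the quadratic, where its value is x - |c|^2 / y. *)
have := P (- c^* / y).
rewrite !rmorphM /= fmorphV rmorphN /= conjCK (CrealP (gtr0_real y_gt0)).
have -> : x + - c^* / y * c + - c / y * c^* + - c^* / y * (- c / y) * y
  = (x * y - c * c^*) / y by field.
by rewrite pmulr_lge0 ?invr_gt0 // subr_ge0.
Qed.

Lemma ctransK m n (A : 'M[C]_(m, n)) : A^h^h = A.
Proof. by apply/matrixP=> i j; rewrite !mxE conjCK. Qed.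

Lemma ctransM m n p (A : 'M[C]_(m, n)) (B : 'M[C]_(n, p)) :
  (A *m B)^h = B^h *m A^h.
Proof. by rewrite /ctrans map_mxM trmx_mul. Qed.

Lemma ctransD m n (A B : 'M[C]_(m, n)) : (A + B)^h = A^h + B^h.
Proof. by apply/matrixP=> i j; rewrite !mxE rmorphD. Qed.

Lemma ctransZ m n c (A : 'M[C]_(m, n)) : (c *: A)^h = c^* *: A^h.
Proof. by apply/matrixP=> i j; rewrite !mxE rmorphM. Qed.

Lemma ctrans1 n : (1%:M : 'M[C]_n)^h = 1%:M.
Proof. by apply/matrixP=> i j; rewrite !mxE rmorph_nat eq_sym. Qed.

Lemma ctrans_diag n (d : 'rV[C]_n) :
  (diag_mx d)^h = diag_mx (map_mx Num.conj d).
Proof.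
apply/matrixP=> i j; rewrite !mxE eq_sym.
by case: eqP => [->|_]; rewrite ?mulr1n // !mulr0n rmorph0.
Qed.

Lemma mxtr_ctrans n (A : 'M[C]_n) : \tr A^h = (\tr A)^*.
Proof. by rewrite /mxtrace rmorph_sum; apply: eq_bigr => i _; rewrite !mxE. Qed.

(** The Hilbert-Schmidt inner product. *)
Definition fdot m n (A B : 'M[C]_(m, n)) : C := \tr (A *m B^h).
Definition fnorm m n (A : 'M[C]_(m, n)) : C := sqrtC (fdot A A).

Lemma fdotE m n (A B : 'M[C]_(m, n)) :
  fdot A B = \sum_i \sum_j A i j * (B i j)^*.
Proof.
apply: eq_bigr => i _; rewrite mxE; apply: eq_bigr => j _; by rewrite !mxE.
Qed.

Lemma fdotC m n (A B : 'M[C]_(m, n)) : fdot B A = (fdot A B)^*.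
Proof. by rewrite /fdot -mxtr_ctrans ctransM ctransK. Qed.

Lemma fdot_ctrans m n (A B : 'M[C]_(m, n)) : fdot A^h B^h = fdot B A.
Proof. by rewrite /fdot ctransK mxtrace_mulC. Qed.

Lemma fdotDl m n (A B D : 'M[C]_(m, n)) : fdot (A + B) D = fdot A D + fdot B D.
Proof. by rewrite /fdot mulmxDl raddfD. Qed.

Lemma fdotDr m n (A B D : 'M[C]_(m, n)) : fdot D (A + B) = fdot D A + fdot D B.
Proof. by rewrite /fdot ctransD mulmxDr raddfD. Qed.

Lemma fdotZl m n c (A B : 'M[C]_(m, n)) : fdot (c *: A) B = c * fdot A B.
Proof. by rewrite /fdot -scalemxAl linearZ. Qed.

Lemma fdotZr m n c (A B : 'M[C]_(m, n)) : fdot A (c *: B) = c^* * fdot A B.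
Proof. by rewrite /fdot ctransZ -scalemxAr linearZ. Qed.

Lemma fdot0r m n (A : 'M[C]_(m, n)) : fdot A 0 = 0.
Proof. by rewrite -[0](scale0r A) fdotZr rmorph0 mul0r. Qed.

Lemma fdot_ge0 m n (A : 'M[C]_(m, n)) : 0 <= fdot A A.
Proof.
rewrite fdotE; apply: sumr_ge0 => i _; apply: sumr_ge0 => j _.
by rewrite -normCK exprn_ge0.
Qed.

Lemma fnorm_ge0 m n (A : 'M[C]_(m, n)) : 0 <= fnorm A.
Proof. by rewrite sqrtC_ge0 fdot_ge0. Qed.

Lemma fnormK m n (A : 'M[C]_(m, n)) : fnorm A ^+ 2 = fdot A A.
Proof. exact: sqrtCK. Qed.

Lemma fnorm_ctrans m n (A : 'M[C]_(m, n)) : fnorm A^h = fnorm A.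
Proof. by rewrite /fnorm fdot_ctrans. Qed.

Lemma fnormZ m n c (A : 'M[C]_(m, n)) : fnorm (c *: A) = `|c| * fnorm A.
Proof.
rewrite /fnorm fdotZl fdotZr mulrA -normCK sqrtCM ?nnegrE ?exprn_ge0 ?fdot_ge0 //.
by rewrite sqrCK.
Qed.

Lemma normC_le_sqrtM c x y : 0 <= x -> 0 <= y ->
  `|c| ^+ 2 <= x * y -> `|c| <= sqrtC x * sqrtC y.
Proof.
move=> x_ge0 y_ge0; rewrite -sqrtCM ?nnegrE // => le_xy.
by rewrite -[`|c|]sqrCK // ler_sqrtC // nnegrE ?exprn_ge0 ?mulr_ge0.
Qed.

Lemma fdot_CauchySchwarz m n (A B : 'M[C]_(m, n)) :
  `|fdot A B| <= fnorm A * fnorm B.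
Proof.
apply: normC_le_sqrtM; rewrite ?fdot_ge0 // mulrC.
apply: discriminant_le; rewrite ?fdot_ge0 // => t.
suff -> : fdot B B + t * fdot A B + (t * fdot A B)^* + t * t^* * fdot A A
  = fdot (t *: A + B) (t *: A + B) by apply: fdot_ge0.
rewrite fdotDl !fdotDr !fdotZl !fdotZr (fdotC A B) rmorphM; ring.
Qed.

(** A hermitian matrix is normal, so the spectral theorem diagonalizes it. The i-th eigenvalue is
    the value of the form of A at the adjoint of the i-th row of U, hence nonnegative. *)
Lemma psd_spectral n (A : 'M[C]_n) : A^h = A -> psd A ->
  exists U : 'M[C]_n, exists d : 'rV[C]_n,
  [/\ U *m U^h = 1%:M, U^h *m U = 1%:M, U *m A *m U^h = diag_mx d
    & forall i, 0 <= d 0 i].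
Proof.
move=> hA pA; exists (spectralmx A), (spectral_diag A).
have ctE k l (B : 'M[C]_(k, l)) : map_mx Num.conj (B^T) = B^h.
  by rewrite /ctrans map_trmx.
have Uu := spectral_unitarymx A.
have UU : spectralmx A *m (spectralmx A)^h = 1%:M.
  by move/unitarymxP: (Uu); rewrite ctE.
have UU' := mulmx1C UU.
have : A \is normalmx by apply/normalmxP; rewrite ctE hA.
move/orthomx_spectralP; rewrite invmx_unitary // ctE => AE.
have D : spectralmx A *m A *m (spectralmx A)^h = diag_mx (spectral_diag A).
  by rewrite {2}AE !mulmxA UU mul1mx -mulmxA UU mulmx1.
split=> // i; have := pA (row i (spectralmx A))^h.
rewrite ctransK -row_mul.
have -> : row i (spectralmx A *m A) *m (row i (spectralmx A))^h
  = (row i (spectralmx A *m A *m (spectralmx A)^h)) *m (delta_mx i 0).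
  apply/matrixP=> p q; rewrite !ord1 -colE !mxE.
  by apply: eq_bigr => k _; rewrite !mxE.
by rewrite D -colE !mxE eqxx mulr1n.
Qed.

(* With v^h v = U^h D U the factors are a = v U^h D^(-1/4) and b = D^(1/4) U;
   where D vanishes so do the columns of v U^h, and 0^-1 = 0 is harmless. *)
Lemma balanced_factorization n m (v : 'M[C]_(n, m)) :
  exists a : 'M[C]_(n, m), exists b : 'M[C]_m,
  [/\ v = a *m b, fnorm (a *m a^h) = fnorm v & fnorm (b^h *m b) = fnorm v].
Proof.
have pv : psd (v^h *m v).
  move=> w; rewrite mulmxA -ctransM -mulmxA.
  rewrite mxE; apply: sumr_ge0 => i _.
  by rewrite !mxE mulrC -normCK exprn_ge0.
have [|U [d [UU UU' D d_ge0]]] := psd_spectral _ pv.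
  by rewrite ctransM ctransK.
pose q i := sqrtC (sqrtC (d 0 i)).
have q_ge0 i : 0 <= q i by rewrite !sqrtC_ge0.
have qK i : q i ^+ 4 = d 0 i by rewrite (exprM _ 2 2) !sqrtCK.
have cq i : (q i)^* = q i by apply/CrealP/ger0_real.
pose Q := diag_mx (\row_i q i).
pose Q' := diag_mx (\row_i (q i)^-1).
have hQ : Q^h = Q.
  by rewrite ctrans_diag; congr diag_mx; apply/rowP=> i; rewrite !mxE cq.
have hQ' : Q'^h = Q'.
  by rewrite ctrans_diag; congr diag_mx; apply/rowP=> i; rewrite !mxE fmorphV /= cq.
have DE : (v *m U^h)^h *m (v *m U^h) = diag_mx d.
  by rewrite ctransM ctransK -D !mulmxA.
(* By [DE] the squared norm of the i-th column of v U^h is d_i. *)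
have col0 k i : d 0 i = 0 -> (v *m U^h) k i = 0.
  move=> di0; have := congr1 (fun M : 'M__ => M i i) DE.
  rewrite mxE (eq_bigr (fun k => `|(v *m U^h) k i| ^+ 2)); last first.
    by move=> l _; rewrite [in LHS]mxE [in LHS]mxE mulrC -normCK.
  rewrite [RHS]mxE eqxx mulr1n di0 => /eqP.
  rewrite psumr_eq0 => [/allP/(_ k (mem_index_enum _))|l _]; last exact: exprn_ge0.
  by rewrite expf_eq0 /= normr_eq0 => /eqP.
exists (v *m U^h *m Q'), (Q *m U); split.
- rewrite mulmxA -[X in X *m U]mulmxA mulmx_diag.
  suff -> : v *m U^h *m diag_mx (\row_j ((\row_i (q i)^-1) 0 j * (\row_i q i) 0 j))
    = v *m U^h by rewrite -mulmxA UU' mulmx1.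
  move: (v *m U^h) col0 => w col0.
  rewrite mul_mx_diag; apply/matrixP=> k i; rewrite !mxE.
  have [di0|di0] := eqVneq (d 0 i) 0; first by rewrite col0 ?mul0r.
  by rewrite mulVf ?mulr1 // !sqrtC_eq0.
(* By cyclicity of the trace the squared norm of a a^h is the trace of Q'^4 D^2. Entrywise q^-4 q^8
   = q^4, so it equals tr D = tr (v v^h). *)
- congr sqrtC; rewrite /fdot ctransM hQ' ctransM !ctransK !ctransM !ctransK hQ'.
  have -> : v *m U^h *m Q' *m (Q' *m (U *m v^h))
      *m (v *m U^h *m Q' *m (Q' *m (U *m v^h)))
    = (v *m U^h) *m (Q' *m Q' *m diag_mx d *m Q' *m Q' *m (U *m v^h)).
    by rewrite -DE ctransM ctransK !mulmxA.
  rewrite mxtrace_mulC -!mulmxA.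
  have -> : U *m (v^h *m (v *m U^h)) = diag_mx d by rewrite -D !mulmxA.
  have -> : \tr (v *m v^h) = \tr (diag_mx d).
    by rewrite -D [RHS]mxtrace_mulC (mulmxA U^h) UU' mul1mx [LHS]mxtrace_mulC.
  congr (\tr _); rewrite !mulmx_diag; congr diag_mx; apply/rowP=> i; rewrite !mxE.
  rewrite -!qK; have [->|q0] := eqVneq (q i) 0; first by rewrite expr0n /= !mulr0.
  by field.
- congr sqrtC; rewrite /fdot !ctransM !ctransK hQ.
  have -> : \tr (v *m v^h) = \tr (diag_mx d).
    by rewrite -D [RHS]mxtrace_mulC (mulmxA U^h) UU' mul1mx [LHS]mxtrace_mulC.
  have -> : U^h *m Q *m (Q *m U) *m (U^h *m Q *m (Q *m U))
    = U^h *m (Q *m Q *m (U *m U^h) *m Q *m Q *m U) by rewrite !mulmxA.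
  rewrite mxtrace_mulC UU mulmx1 -!mulmxA UU mulmx1 !mulmx_diag.
  congr (\tr (diag_mx _)); apply/rowP=> i; rewrite !mxE -qK; ring.
Qed.

(** With A = U^h D U take t = U^h (D + r)^(-1/2) and s = (D + r)^(1/2) U. Since A may be singular, r
    > 0 is what makes the root invertible; s serves to undo the congruence by t. *)
Lemma pos_whitening n (A : 'M[C]_n) r : A^h = A -> psd A -> 0 < r ->
  exists t s : 'M[C]_n, t^h *m (A + r%:M) *m t = 1%:M /\ t *m s = 1%:M.
Proof.
move=> hA pA r_gt0; have [U [d [UU UU' D d_ge0]]] := psd_spectral hA pA.
have f_gt0 i : 0 < d 0 i + r by rewrite ltr_wpDl.
pose q i := sqrtC (d 0 i + r).
have q_gt0 i : 0 < q i by rewrite sqrtC_gt0.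
have q_neq0 i : q i != 0 by rewrite gt_eqF.
pose Q := diag_mx (\row_i q i).
pose Q' := diag_mx (\row_i (q i)^-1).
have hQ' : Q'^h = Q'.
  rewrite ctrans_diag; congr diag_mx; apply/rowP=> i.
  by rewrite !mxE fmorphV /= (CrealP _) // gtr0_real.
exists (U^h *m Q'), (Q *m U); split.
  rewrite ctransM ctransK hQ'.
  have -> : Q' *m U *m (A + r%:M) *m (U^h *m Q')
    = Q' *m (U *m A *m U^h + U *m r%:M *m U^h) *m Q'.
    by rewrite !(mulmxDl, mulmxDr) !mulmxA.
  have -> : U *m r%:M *m U^h = r%:M by rewrite scalar_mxC -mulmxA UU mulmx1.
  rewrite D.
  rewrite -(diag_const_mx n r) -raddfD /= !mulmx_diag -diag_const_mx.
  congr diag_mx; apply/rowP=> i; rewrite !mxE -[d 0 i + r]sqrtCK -/(q i).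
  by field.
rewrite mulmxA -[U^h *m Q' *m Q]mulmxA mulmx_diag.
have -> : diag_mx (\row_j ((\row_i (q i)^-1) 0 j * (\row_i q i) 0 j)) = 1%:M.
  rewrite -diag_const_mx; congr diag_mx; apply/rowP=> i.
  by rewrite !mxE mulVf.
by rewrite mulmx1.
Qed.

End ComplexMatrices.

(** * Suprema, infima and the operator norm *)

Section OperatorNorm.
Variables (C : numClosedFieldType) (hC : complete_reals C).

Lemma is_glb_unique (S : C -> Prop) s t : is_glb S s -> is_glb S t -> s = t.
Proof.
move=> [sr [sub slub]] [tr [tub tlub]].
by apply: le_anti; rewrite slub // tlub.
Qed.

(** [cinf] is a choice by [epsilon], so its value is known only once some greatest lower bound is
    exhibited. *)
Lemma cinf_eq (S : C -> Prop) s : is_glb S s -> cinf S = s.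
Proof.
move=> ls; apply: is_glb_unique (ls).
by apply: (epsilon_spec (inhabits 0) (is_glb S)); exists s.
Qed.

Lemma vnormE k (v : 'cV[C]_k) : vnorm v = fnorm v.
Proof. by rewrite /vnorm /fnorm /fdot mxtrace_mulC /mxtrace big_ord1. Qed.

Lemma fnorm0_eq0 m n (A : 'M[C]_(m, n)) : fnorm A = 0 -> A = 0.
Proof.
move/(congr1 (fun x => x ^+ 2)); rewrite fnormK expr0n fdotE => /eqP.
rewrite psumr_eq0 => [/allP A0|i _]; last first.
  by apply: sumr_ge0 => j _; rewrite -normCK exprn_ge0.
apply/matrixP=> i j; rewrite mxE; have /= := A0 i (mem_index_enum _).
rewrite psumr_eq0 => [/allP/(_ j (mem_index_enum _))|k _]; last first.
  by rewrite -normCK exprn_ge0.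
by rewrite /= mulf_eq0 conjC_eq0 orbb => /eqP.
Qed.

Lemma fnorm0 m n : fnorm (0 : 'M[C]_(m, n)) = 0.
Proof. by rewrite /fnorm /fdot mul0mx raddf0 sqrtC0. Qed.

(** Cauchy-Schwarz on each row of M. It serves to show that the set defining [opnorm] is bounded. *)
Lemma fnorm_mulmx_col p q (M : 'M[C]_(p, q)) (v : 'cV[C]_q) :
  fnorm (M *m v) <= fnorm M * fnorm v.
Proof.
rewrite -ler_sqr ?nnegrE ?mulr_ge0 ?fnorm_ge0 // exprMn !fnormK.
rewrite [leLHS]fdotE [fdot M M]fdotE mulr_suml; apply: ler_sum => i _.
rewrite big_ord1 -normCK.
have -> : (M *m v) i 0 = fdot (row i M) v^h.
  by rewrite /fdot ctransK -row_mul /mxtrace big_ord1 [RHS]mxE.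
have := fdot_CauchySchwarz (row i M) v^h; rewrite fnorm_ctrans => le1.
apply: le_trans (_ : (fnorm (row i M) * fnorm v) ^+ 2 <= _).
  by rewrite ler_sqr ?nnegrE ?mulr_ge0 ?fnorm_ge0.
rewrite exprMn !fnormK ler_wpM2r ?fdot_ge0 // fdotE big_ord1.
by rewrite le_eqVlt; apply/predU1P; left; apply: eq_bigr => j _; rewrite !mxE.
Qed.

Lemma opnorm_lub p q (M : 'M[C]_(p, q)) :
  is_lub (fun r => exists v : 'cV[C]_q, vnorm v <= 1 /\ r = vnorm (M *m v))
    (opnorm M).
Proof.
apply: (epsilon_spec (inhabits 0)); apply: hC.
- by move=> x [v [_ ->]]; rewrite vnormE ger0_real ?fnorm_ge0.
- exists (vnorm (M *m 0)), 0; split=> //.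
  by rewrite vnormE fnorm0 ler01.
exists (fnorm M); split; first by rewrite ger0_real ?fnorm_ge0.
move=> x [v [v1 ->]]; rewrite vnormE; apply: le_trans (fnorm_mulmx_col _ _) _.
by rewrite vnormE in v1; rewrite ler_piMr ?fnorm_ge0.
Qed.

Lemma opnorm_ge0 p q (M : 'M[C]_(p, q)) : 0 <= opnorm M.
Proof.
have [_ [ub _]] := opnorm_lub M; apply: le_trans (ub (vnorm (M *m 0)) _).
  by rewrite vnormE fnorm_ge0.
by exists 0; rewrite vnormE fnorm0 ler01.
Qed.

(** Trades the supremum over the unit ball for a bound on a sesquilinear form. One direction
    normalizes v and uses Cauchy-Schwarz; the other tests u = M v. *)
Lemma opnorm_leP p q (M : 'M[C]_(p, q)) (r : C) : 0 <= r ->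
  opnorm M <= r <->
  (forall (u : 'cV[C]_p) (v : 'cV[C]_q),
     `|(u^h *m M *m v) 0 0| <= r * fnorm u * fnorm v).
Proof.
move=> r_ge0; have [_ [ub lub]] := opnorm_lub M.
have formE (u : 'cV[C]_p) (v : 'cV[C]_q) : (u^h *m M *m v) 0 0 = fdot (M *m v) u.
  by rewrite /fdot mxtrace_mulC /mxtrace big_ord1 mulmxA.
split=> [le_r u v|le_r].
  rewrite formE; apply: le_trans (fdot_CauchySchwarz _ _) _.
  rewrite mulrAC ler_wpM2r ?fnorm_ge0 //.
  have [v0|v0] := eqVneq (fnorm v) 0.
    by rewrite (fnorm0_eq0 v0) mulmx0 !fnorm0 mulr0.
  have v_gt0 : 0 < fnorm v by rewrite lt0r v0 fnorm_ge0.
  rewrite -ler_pdivrMr //; apply: le_trans le_r; apply: ub.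
  have nV : `|(fnorm v)^-1| = (fnorm v)^-1 by rewrite ger0_norm // invr_ge0 fnorm_ge0.
  exists ((fnorm v)^-1 *: v); rewrite !vnormE -scalemxAr !fnormZ nV mulVf //.
  by rewrite mulrC.
apply: lub; first exact: ger0_real.
move=> x [v [v1 ->]]; rewrite vnormE; rewrite vnormE in v1.
have := le_r (M *m v) v.
rewrite formE -fnormK ger0_norm ?exprn_ge0 ?fnorm_ge0 //.
have := fnorm_ge0 (M *m v); rewrite le0r => /predU1P[-> //|Mv_gt0].
rewrite expr2 mulrAC ler_pM2r // => /le_trans; apply.
by rewrite ler_piMr.
Qed.

End OperatorNorm.

(** * Matrices over [H]: scalar matrix actions, inner product, sesquilinear forms *)

Section Actions.
Variables (C : numClosedFieldType) (H : lmodType C) (HS : hilbert_star H).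
Local Notation ip := (ip HS).
Local Notation star := (star HS).

Lemma ipDl x y z : ip (x + y) z = ip x z + ip y z.
Proof. by have := ip_linl HS 1 x y z; rewrite scale1r mul1r. Qed.

Lemma ip0l z : ip 0 z = 0.
Proof. by apply: (addrI (ip 0 z)); rewrite -ipDl !addr0. Qed.

Lemma ipZl a x z : ip (a *: x) z = a * ip x z.
Proof. by have := ip_linl HS a x 0 z; rewrite ip0l !addr0. Qed.

Lemma ip_conj x y : (ip x y)^* = ip y x.
Proof. by rewrite -ip_conjsym. Qed.

Lemma ipDr x y z : ip z (x + y) = ip z x + ip z y.
Proof. by rewrite -ip_conj ipDl rmorphD /= !ip_conj. Qed.

Lemma ipZr a x z : ip z (a *: x) = a^* * ip z x.
Proof. by rewrite -ip_conj ipZl rmorphM /= !ip_conj. Qed.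

Lemma ip0r z : ip z 0 = 0.
Proof. by rewrite -ip_conj ip0l rmorph0. Qed.

Lemma ip_suml I (s : seq I) (P : pred I) F z :
  ip (\sum_(i <- s | P i) F i) z = \sum_(i <- s | P i) ip (F i) z.
Proof. exact: (big_morph (ip^~ z) (fun x y => ipDl x y z) (ip0l z)). Qed.

Lemma ip_sumr I (s : seq I) (P : pred I) F z :
  ip z (\sum_(i <- s | P i) F i) = \sum_(i <- s | P i) ip z (F i).
Proof. exact: (big_morph (ip z) (fun x y => ipDr x y z) (ip0r z)). Qed.

Lemma ip_ge0 x : 0 <= ip x x.
Proof.
by have [->|/(ip_posdef HS)/ltW //] := eqVneq x 0; rewrite ip0l.
Qed.

Lemma starD x y : star (x + y) = star x + star y.
Proof. by have := star_semilin HS 1 x y; rewrite rmorph1 !scale1r. Qed.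

Lemma star0 : star 0 = 0.
Proof. by apply: (addrI (star 0)); rewrite -starD !addr0. Qed.

Lemma starZ a x : star (a *: x) = a^* *: star x.
Proof. by have := star_semilin HS a x 0; rewrite star0 !addr0. Qed.

Lemma star_sum I (s : seq I) (P : pred I) F :
  star (\sum_(i <- s | P i) F i) = \sum_(i <- s | P i) star (F i).
Proof. exact: (big_morph star starD star0). Qed.

Definition lact p n m (a : 'M[C]_(p, n)) (z : 'M[H]_(n, m)) : 'M[H]_(p, m) :=
  \matrix_(i, j) \sum_k a i k *: z k j.
Definition ract n m q (z : 'M[H]_(n, m)) (a : 'M[C]_(m, q)) : 'M[H]_(n, q) :=
  \matrix_(i, j) \sum_k a k j *: z i k.
Definition hdot n m (A B : 'M[H]_(n, m)) : C := \sum_i \sum_j ip (A i j) (B i j).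

Lemma lactM p q n m (a : 'M[C]_(p, q)) (b : 'M[C]_(q, n)) (z : 'M[H]_(n, m)) :
  lact a (lact b z) = lact (a *m b) z.
Proof.
apply/matrixP=> i j; rewrite !mxE.
under eq_bigr do rewrite mxE scaler_sumr.
rewrite exchange_big; apply: eq_bigr => k _.
by rewrite mxE scaler_suml; apply: eq_bigr => l _; rewrite scalerA.
Qed.

Lemma ractM n m p q (z : 'M[H]_(n, m)) (a : 'M[C]_(m, p)) (b : 'M[C]_(p, q)) :
  ract (ract z a) b = ract z (a *m b).
Proof.
apply/matrixP=> i j; rewrite !mxE.
under eq_bigr do rewrite mxE scaler_sumr.
rewrite exchange_big; apply: eq_bigr => k _.
by rewrite mxE scaler_suml; apply: eq_bigr => l _; rewrite scalerA mulrC.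
Qed.

Lemma lract_comm p n m q (a : 'M[C]_(p, n)) (z : 'M[H]_(n, m)) (b : 'M[C]_(m, q)) :
  ract (lact a z) b = lact a (ract z b).
Proof.
apply/matrixP=> i j; rewrite !mxE.
under eq_bigr do rewrite mxE scaler_sumr.
rewrite exchange_big; apply: eq_bigr => k _.
by rewrite mxE scaler_sumr; apply: eq_bigr => l _; rewrite !scalerA mulrC.
Qed.

Lemma lact1 n m (z : 'M[H]_(n, m)) : lact 1%:M z = z.
Proof.
apply/matrixP=> i j; rewrite !mxE (bigD1 i) //= mxE eqxx scale1r big1 ?addr0 //.
by move=> k /negPf ki; rewrite mxE eq_sym ki scale0r.
Qed.

Lemma ract1 n m (z : 'M[H]_(n, m)) : ract z 1%:M = z.
Proof.
apply/matrixP=> i j; rewrite !mxE (bigD1 j) //= mxE eqxx scale1r big1 ?addr0 //.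
by move=> k /negPf ki; rewrite mxE ki scale0r.
Qed.

Lemma lactDl p n m (a b : 'M[C]_(p, n)) (z : 'M[H]_(n, m)) :
  lact (a + b) z = lact a z + lact b z.
Proof.
apply/matrixP=> i j; rewrite !mxE -big_split; apply: eq_bigr => k _.
by rewrite mxE scalerDl.
Qed.

Lemma lactDr p n m (a : 'M[C]_(p, n)) (y z : 'M[H]_(n, m)) :
  lact a (y + z) = lact a y + lact a z.
Proof.
apply/matrixP=> i j; rewrite !mxE -big_split; apply: eq_bigr => k _.
by rewrite mxE scalerDr.
Qed.

Lemma ractDl n m q (y z : 'M[H]_(n, m)) (a : 'M[C]_(m, q)) :
  ract (y + z) a = ract y a + ract z a.
Proof.
apply/matrixP=> i j; rewrite !mxE -big_split; apply: eq_bigr => k _.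
by rewrite mxE scalerDr.
Qed.

Lemma ractDr n m q (z : 'M[H]_(n, m)) (a b : 'M[C]_(m, q)) :
  ract z (a + b) = ract z a + ract z b.
Proof.
apply/matrixP=> i j; rewrite !mxE -big_split; apply: eq_bigr => k _.
by rewrite mxE scalerDl.
Qed.

Lemma hipDl n m (A B D : 'M[H]_(n, m)) : hdot (A + B) D = hdot A D + hdot B D.
Proof.
rewrite -big_split; apply: eq_bigr => i _; rewrite -big_split.
by apply: eq_bigr => j _; rewrite mxE ipDl.
Qed.

Lemma hip_conj n m (A B : 'M[H]_(n, m)) : (hdot A B)^* = hdot B A.
Proof.
rewrite rmorph_sum; apply: eq_bigr => i _; rewrite rmorph_sum.
by apply: eq_bigr => j _; apply: ip_conj.
Qed.

Lemma hipDr n m (A B D : 'M[H]_(n, m)) : hdot D (A + B) = hdot D A + hdot D B.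
Proof. by rewrite -hip_conj hipDl rmorphD /= !hip_conj. Qed.

Lemma hip_ge0 n m (A : 'M[H]_(n, m)) : 0 <= hdot A A.
Proof. by apply: sumr_ge0 => i _; apply: sumr_ge0 => j _; apply: ip_ge0. Qed.

Lemma hipZl n c (A B : 'M[H]_n) : hdot (scalemxH c A) B = c * hdot A B.
Proof.
rewrite /hdot mulr_sumr; apply: eq_bigr => i _; rewrite mulr_sumr.
by apply: eq_bigr => j _; rewrite mxE ipZl.
Qed.

Lemma hipZr n c (A B : 'M[H]_n) : hdot A (scalemxH c B) = c^* * hdot A B.
Proof. by rewrite -hip_conj hipZl rmorphM /= hip_conj. Qed.

Lemma hip_CauchySchwarz n (A B : 'M[H]_n) :
  `|hdot A B| ^+ 2 <= hdot A A * hdot B B.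
Proof.
rewrite mulrC; apply: discriminant_le; rewrite ?hip_ge0 // => t.
suff -> : hdot B B + t * hdot A B + (t * hdot A B)^* + t * t^* * hdot A A
  = hdot (scalemxH t A + B) (scalemxH t A + B) by apply: hip_ge0.
rewrite hipDl !hipDr !hipZl !hipZr rmorphM /= hip_conj; ring.
Qed.

Lemma hip_lact p n m (a : 'M[C]_(p, n)) (z : 'M[H]_(n, m)) (x : 'M[H]_(p, m)) :
  hdot (lact a z) x = hdot z (lact a^h x).
Proof.
rewrite /hdot exchange_big [RHS]exchange_big; apply: eq_bigr => j _.
under eq_bigr do rewrite mxE ip_suml.
rewrite exchange_big; apply: eq_bigr => k _; rewrite mxE ip_sumr.
by apply: eq_bigr => i _; rewrite ipZl ipZr !mxE conjCK.
Qed.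

Lemma hip_ract n m q (z : 'M[H]_(n, m)) (a : 'M[C]_(m, q)) (x : 'M[H]_(n, q)) :
  hdot (ract z a) x = hdot z (ract x a^h).
Proof.
apply: eq_bigr => i _.
under eq_bigr do rewrite mxE ip_suml.
rewrite exchange_big; apply: eq_bigr => k _; rewrite mxE ip_sumr.
by apply: eq_bigr => j _; rewrite ipZl ipZr !mxE conjCK.
Qed.

Lemma mstar_lact p n m (a : 'M[C]_(p, n)) (z : 'M[H]_(n, m)) :
  mstar HS (lact a z) = ract (mstar HS z) a^h.
Proof.
apply/matrixP=> i j; rewrite !mxE star_sum; apply: eq_bigr => k _.
by rewrite starZ !mxE.
Qed.

Lemma mstar_ract n m q (z : 'M[H]_(n, m)) (a : 'M[C]_(m, q)) :
  mstar HS (ract z a) = lact a^h (mstar HS z).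
Proof.
apply/matrixP=> i j; rewrite !mxE star_sum; apply: eq_bigr => k _.
by rewrite starZ !mxE.
Qed.

Lemma mstarD n m (y z : 'M[H]_(n, m)) : mstar HS (y + z) = mstar HS y + mstar HS z.
Proof. by apply/matrixP=> i j; rewrite !mxE starD. Qed.

Lemma mstarZ n c (z : 'M[H]_n) : mstar HS (scalemxH c z) = scalemxH c^* (mstar HS z).
Proof. by apply/matrixP=> i j; rewrite !mxE starZ. Qed.

Lemma mstarK n m (z : 'M[H]_(n, m)) : mstar HS (mstar HS z) = z.
Proof. by apply/matrixP=> i j; rewrite !mxE star_invol. Qed.

Lemma hip_mstar n m (A B : 'M[H]_(n, m)) : hdot (mstar HS A) (mstar HS B) = hdot B A.
Proof.
rewrite /hdot exchange_big; apply: eq_bigr => i _; apply: eq_bigr => j _.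
by rewrite !mxE star_ip ip_conj.
Qed.

Lemma congr_actE n m (a : 'M[C]_(n, m)) (x : 'M[H]_n) :
  congr_act a x = lact a^h (ract x a).
Proof.
apply/matrixP=> i j; rewrite !mxE; apply: eq_bigr => k _.
rewrite !mxE scaler_sumr; apply: eq_bigr => l _.
by rewrite scalerA.
Qed.

(* The sesquilinear form of the matrix <<z, bar x>> on C^n (x) C^m, identified
   with 'M[C]_(n, m). *)
Definition qform n m (z : 'M[H]_n) (x : 'M[H]_m) (u v : 'M[C]_(n, m)) : C :=
  hdot (lact u^h (ract z v)) x.

Lemma qfDl n m (y z : 'M[H]_n) (x : 'M[H]_m) u v :
  qform (y + z) x u v = qform y x u v + qform z x u v.
Proof. by rewrite /qform ractDl lactDr hipDl. Qed.

Lemma qfDr n m (z : 'M[H]_n) (x y : 'M[H]_m) u v :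
  qform z (x + y) u v = qform z x u v + qform z y u v.
Proof. by rewrite /qform hipDr. Qed.

Lemma qfDu n m (z : 'M[H]_n) (x : 'M[H]_m) u u' v :
  qform z x (u + u') v = qform z x u v + qform z x u' v.
Proof. by rewrite /qform ctransD lactDl hipDl. Qed.

Lemma qfDv n m (z : 'M[H]_n) (x : 'M[H]_m) u v v' :
  qform z x u (v + v') = qform z x u v + qform z x u v'.
Proof. by rewrite /qform ractDr lactDr hipDl. Qed.

Lemma qfZr n m c (z : 'M[H]_n) (x : 'M[H]_m) u v :
  qform z (scalemxH c x) u v = c^* * qform z x u v.
Proof. by rewrite /qform hipZr. Qed.

(** The right factors c and d pass to the side of x by taking adjoints. A value of the form thus
    becomes an inner product whose first entry involves only z and whose second only x, which is
    what Cauchy-Schwarz needs. *)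
Lemma qf_congr n m k l (a b : 'M[C]_(n, k)) (c d : 'M[C]_(l, m)) (z : 'M[H]_n)
    (x : 'M[H]_m) (u v : 'M[C]_(k, l)) :
  qform z x (a *m u *m c) (b *m v *m d)
  = hdot (lact (a *m u)^h (ract z (b *m v))) (lact c (ract x d^h)).
Proof.
rewrite /qform ctransM -(lactM c^h) -(ractM z (b *m v)) hip_lact ctransK.
by rewrite -lract_comm hip_ract lract_comm.
Qed.

(** The flip of the two tensor factors. Exchanging z and x conjugates the inner products, and test
    matrices of size m x n become n x m through their adjoints. *)
Lemma qf_sym n m (z : 'M[H]_n) (x : 'M[H]_m) u v :
  qform x z u v = (qform z x u^h v^h)^*.
Proof.
rewrite {2}/qform ctransK hip_conj -hip_conj hip_lact hip_ract ctransK hip_conj.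
by rewrite lract_comm.
Qed.

Lemma qfZl n m c (z : 'M[H]_n) (x : 'M[H]_m) u v :
  qform (scalemxH c z) x u v = c * qform z x u v.
Proof. by rewrite qf_sym qfZr rmorphM /= conjCK -qf_sym. Qed.

Lemma qf_congr_act n m k (a : 'M[C]_(n, k)) (z : 'M[H]_n) (x : 'M[H]_m) u v :
  qform (congr_act a z) x u v = qform z x (a *m u) (a *m v).
Proof.
by rewrite congr_actE /qform lract_comm lactM ractM ctransM.
Qed.

(** The involution conjugates inner products and exchanges left and right actions. For hermitian z
    and x the form is therefore hermitian. *)
Lemma qf_mstar n m (z : 'M[H]_n) (x : 'M[H]_m) u v :
  qform (mstar HS z) (mstar HS x) u v = (qform z x v u)^*.
Proof.
rewrite /qform hip_conj -hip_mstar mstar_lact mstar_ract ctransK mstarK.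
by rewrite mstarK lract_comm.
Qed.

Lemma qf_herm n m (z : 'M[H]_n) (x : 'M[H]_m) u v :
  herm HS z -> herm HS x -> (qform z x u v)^* = qform z x v u.
Proof. by move=> hz hx; rewrite -qf_mstar hz hx. Qed.

Lemma qf_real n m (z : 'M[H]_n) (x : 'M[H]_m) u :
  herm HS z -> herm HS x -> qform z x u u \is Num.real.
Proof. by move=> hz hx; apply/CrealP; rewrite qf_herm. Qed.

Lemma qfZu n m c (z : 'M[H]_n) (x : 'M[H]_m) u v :
  qform z x (c *: u) v = c^* * qform z x u v.
Proof.
rewrite /qform ctransZ -hipZl; congr hdot; apply/matrixP=> i j; rewrite !mxE.
by rewrite scaler_sumr; apply: eq_bigr => k _; rewrite mxE scalerA.
Qed.

Lemma qfZv n m c (z : 'M[H]_n) (x : 'M[H]_m) u v :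
  qform z x u (c *: v) = c * qform z x u v.
Proof.
rewrite /qform -hipZl; congr hdot; apply/matrixP=> i j; rewrite !mxE scaler_sumr.
apply: eq_bigr => k _; rewrite scalerA mulrC -scalerA; congr (_ *: _).
by rewrite !mxE scaler_sumr; apply: eq_bigr => l _; rewrite mxE scalerA.
Qed.

(** * Norm bounds on pairings, free of suprema, and Haagerup's inequality *)

Definition qbounded n m (z : 'M[H]_n) (x : 'M[H]_m) (r : C) : Prop :=
  forall u v, `|qform z x u v| <= r * fnorm u * fnorm v.

Lemma Haagerup_CauchySchwarz n m (z : 'M[H]_n) (x : 'M[H]_m) r s :
  0 <= r -> 0 <= s -> qbounded z z (r ^+ 2) -> qbounded x x (s ^+ 2) ->
  qbounded z x (r * s).
Proof.
move=> r_ge0 s_ge0 zr xs u v.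
have [c [d [uE cc dd]]] := balanced_factorization u.
have [a [b [vE aa bb]]] := balanced_factorization v.
pose A := lact c^h (ract z a); pose B := lact d (ract x b^h).
have -> : qform z x u v = hdot A B.
  rewrite uE vE; have := qf_congr c a d b z x 1%:M 1%:M.
  by rewrite !mulmx1.
(* The norms of A and B are themselves values of forms, at test matrices which the balanced
   factorization keeps at the norms of u and v. *)
have AE : hdot A A = qform z z (c *m c^h) (a *m a^h).
  have := qf_congr c a c^h a^h z z 1%:M 1%:M.
  by rewrite !mulmx1 ctransK.
have BE : hdot B B = qform x x (d^h *m d) (b^h *m b).
  have := qf_congr d^h b^h d b x x 1%:M 1%:M.
  by rewrite !mulmx1 ctransK.
have AA : hdot A A <= r ^+ 2 * fnorm u * fnorm v.
  by rewrite -[hdot A A]ger0_norm ?hip_ge0 // AE -cc -aa.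
have BB : hdot B B <= s ^+ 2 * fnorm u * fnorm v.
  by rewrite -[hdot B B]ger0_norm ?hip_ge0 // BE -dd -bb.
rewrite -ler_sqr ?nnegrE ?mulr_ge0 ?fnorm_ge0 //.
apply: le_trans (hip_CauchySchwarz A B) _.
apply: le_trans (ler_pM (hip_ge0 A) (hip_ge0 B) AA BB) _.
by rewrite le_eqVlt; apply/predU1P; left; ring.
Qed.

(** The hypothesis is positivity of the 2 x 2 block matrix with r on the diagonal and the pairing
    and its adjoint off it. Replacing v by t v for complex t yields the quadratic of
    [discriminant_le]. *)
Lemma qbounded_discriminant n m (z : 'M[H]_n) (x : 'M[H]_m) r : 0 <= r ->
  (forall u v, 0 <= r * (fdot u u + fdot v v) + qform z x u v + (qform z x u v)^*) ->
  qbounded z x r.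
Proof.
move=> r_ge0 P u v.
have : `|qform z x u v| ^+ 2 <= (r * fdot u u) * (r * fdot v v).
  apply: discriminant_le; rewrite ?mulr_ge0 ?fdot_ge0 // => t.
  have := P u (t *: v); rewrite qfZv fdotZl fdotZr.
  by congr (0 <= _); ring.
rewrite -!fnormK => le2.
rewrite -ler_sqr ?nnegrE ?mulr_ge0 ?fnorm_ge0 //.
by apply: le_trans le2 _; rewrite le_eqVlt; apply/predU1P; left; ring.
Qed.

(** A hermitian form is controlled by its diagonal. By polarization, the lower bound at u + v and
    the upper bound at u - v add up to twice the hypothesis of [qbounded_discriminant]. *)
Lemma qbounded_diag n m (z : 'M[H]_n) (x : 'M[H]_m) r : 0 <= r ->
  herm HS z -> herm HS x ->
  (forall u, `|qform z x u u| <= r * fdot u u) -> qbounded z x r.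
Proof.
move=> r_ge0 hz hx P; apply: qbounded_discriminant => // u v.
rewrite (qf_herm _ _ hz hx).
have le1 : 0 <= r * fdot (u + v) (u + v) + qform z x (u + v) (u + v).
  have := P (u + v); rewrite real_norm_le ?qf_real // => /andP[+ _].
  by rewrite addrC.
have le2 : 0 <= r * fdot (u - v) (u - v) - qform z x (u - v) (u - v).
  have := P (u - v); by rewrite real_norm_le ?qf_real // => /andP[].
have := addr_ge0 le1 le2; rewrite -[- v]scaleN1r.
rewrite !(qfDu, qfDv, qfZu, qfZv, fdotDl, fdotDr, fdotZl, fdotZr) rmorphN1.
set q := (X in 0 <= X -> _).
suff -> : q = 2 * (r * (fdot u u + fdot v v) + qform z x u v + qform z x v u).
  by rewrite pmulr_rge0.
rewrite /q; ring.
Qed.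

(** The triangle inequality for ||.||_o, with the cross terms estimated by Haagerup's inequality. *)
Lemma qboundedD n (y z : 'M[H]_n) r s : 0 <= r -> 0 <= s ->
  qbounded y y (r ^+ 2) -> qbounded z z (s ^+ 2) ->
  qbounded (y + z) (y + z) ((r + s) ^+ 2).
Proof.
move=> r_ge0 s_ge0 yr zs u v; rewrite !qfDl !qfDr sqrrD mulr2n.
have yz := Haagerup_CauchySchwarz r_ge0 s_ge0 yr zs u v.
have zy := Haagerup_CauchySchwarz s_ge0 r_ge0 zs yr u v.
have -> : (r ^+ 2 + (r * s + r * s) + s ^+ 2) * fnorm u * fnorm v =
  (r ^+ 2 * fnorm u * fnorm v + r * s * fnorm u * fnorm v) +
  (s * r * fnorm u * fnorm v + s ^+ 2 * fnorm u * fnorm v) by ring.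
apply: le_trans (ler_normD _ _) (lerD _ _).
  by apply: le_trans (ler_normD _ _) (lerD (yr _ _) yz).
by apply: le_trans (ler_normD _ _) (lerD zy (zs _ _)).
Qed.

(** * Matrix pairings as sesquilinear forms on vectorized matrices *)

Lemma unpairK n m :
  cancel (fun ij : 'I_n * 'I_m => mxvec_index ij.1 ij.2) (@unpair n m).
Proof. by case=> i j; rewrite /unpair /mxvec_index cast_ordK enum_rankK. Qed.

Lemma mxvec_unpair n m (p : 'I_(n * m)) : mxvec_index (unpair p).1 (unpair p).2 = p.
Proof. by case/mxvec_indexP: p => i j; rewrite (unpairK (i, j)). Qed.

Lemma sum_unpair n m (F : 'I_n -> 'I_m -> C) :
  \sum_(p < n * m) F (unpair p).1 (unpair p).2 = \sum_i \sum_j F i j.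
Proof.
rewrite pair_bigA (reindex (fun ij : 'I_n * 'I_m => mxvec_index ij.1 ij.2)) /=.
  by apply: eq_bigr => ij _; rewrite unpairK.
exists (@unpair n m) => p _; [exact: unpairK | exact: mxvec_unpair].
Qed.

Definition colmx n m (u : 'M[C]_(n, m)) : 'cV[C]_(n * m) :=
  \col_p u (unpair p).1 (unpair p).2.
Definition uncolmx n m (w : 'cV[C]_(n * m)) : 'M[C]_(n, m) :=
  \matrix_(i, j) w (mxvec_index i j) 0.

Lemma uncolmxK n m (w : 'cV[C]_(n * m)) : colmx (uncolmx w) = w.
Proof. by apply/colP=> p; rewrite !mxE mxvec_unpair. Qed.

Lemma fnorm_colmx n m (u : 'M[C]_(n, m)) : fnorm (colmx u) = fnorm u.
Proof.
congr sqrtC; rewrite !fdotE -(sum_unpair (fun i j => u i j * (u i j)^*)).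
apply: eq_bigr => p _.
by rewrite big_ord1 !mxE.
Qed.

Lemma pairing_form n m (z : 'M[H]_n) (x : 'M[H]_m) u v :
  ((colmx u)^h *m pairing HS z x *m colmx v) 0 0 = qform z x u v.
Proof.
rewrite mxE.
under eq_bigr do rewrite mxE mulr_suml.
rewrite /qform /hdot.
pose G i j k l := (u i j)^* * ip (z i k) (x j l) * v k l.
transitivity (\sum_i \sum_j \sum_k \sum_l G i j k l).
  rewrite exchange_big -(sum_unpair (fun i j => \sum_k \sum_l G i j k l)).
  apply: eq_bigr => p _; rewrite -(sum_unpair (fun k l => G _ _ k l)).
  by apply: eq_bigr => q _; rewrite !mxE.
rewrite exchange_big; apply: eq_bigr => j _.
transitivity (\sum_i \sum_l \sum_k G i j k l).
  by apply: eq_bigr => i _; rewrite exchange_big.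
rewrite exchange_big; apply: eq_bigr => l _; rewrite mxE ip_suml.
apply: eq_bigr => i _; rewrite !mxE scaler_sumr ip_suml; apply: eq_bigr => k _.
by rewrite scalerA ipZl /G mulrAC.
Qed.

End Actions.

(** * The unital Hilbert space: states eta + e and the cone [Co] *)

Section UnitalHilbert.
Variables (C : numClosedFieldType) (hC : complete_reals C).
Variables (H : lmodType C) (HS : hilbert_star H) (e : H).
Hypotheses (e_herm : star HS e = e) (e_unit : ip HS e e = 1).
Local Notation ip := (ip HS).
Local Notation star := (star HS).
Local Notation qf := (qform HS).
Local Notation qbounded := (qbounded HS).
Local Notation hip := (hdot HS).
Local Notation herm := (herm HS).
Local Notation mstar := (mstar HS).
Local Notation pair_e := (pair_e HS e).
Local Notation emx := (emx e).
Local Notation Beh := (Beh HS e).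
Local Notation Co := (Co HS e).
Local Notation onorm := (onorm HS).

Lemma psd_pairingP n m (z : 'M[H]_n) (x : 'M[H]_m) :
  psd (pairing HS z x) <-> (forall u, 0 <= qf z x u u).
Proof.
split=> [P u|P w]; first by rewrite -pairing_form.
by rewrite -[w]uncolmxK pairing_form.
Qed.

Lemma opnorm_pairingP n m (z : 'M[H]_n) (x : 'M[H]_m) r : 0 <= r ->
  opnorm (pairing HS z x) <= r <-> qbounded z x r.
Proof.
move=> r_ge0; split=> [/(opnorm_leP hC _ r_ge0) P u v|P].
  by rewrite -pairing_form -(fnorm_colmx u) -(fnorm_colmx v).
apply/(opnorm_leP hC _ r_ge0) => u v.
by rewrite -[u]uncolmxK -[v]uncolmxK pairing_form !fnorm_colmx.
Qed.

Lemma onormK n (z : 'M[H]_n) : onorm z ^+ 2 = opnorm (pairing HS z z).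
Proof. exact: sqrtCK. Qed.

Lemma onorm_ge0 n (z : 'M[H]_n) : 0 <= onorm z.
Proof. by rewrite sqrtC_ge0 opnorm_ge0. Qed.

Lemma onorm_leP n (z : 'M[H]_n) s : 0 <= s ->
  onorm z <= s <-> qbounded z z (s ^+ 2).
Proof.
move=> s_ge0; rewrite -ler_sqr ?nnegrE ?onorm_ge0 // onormK.
by apply: opnorm_pairingP; rewrite exprn_ge0.
Qed.

Lemma onorm_qbounded n (z : 'M[H]_n) : qbounded z z (onorm z ^+ 2).
Proof. by apply/onorm_leP; rewrite ?onorm_ge0. Qed.

(** The elementary tensor a (x) e. *)
Definition tens n (a : 'M[C]_n) : 'M[H]_n := \matrix_(i, j) (a i j *: e).

Lemma emxE n : emx n = tens 1%:M.
Proof.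
by apply/matrixP=> i j; rewrite !mxE; case: eqP; rewrite ?scale1r ?scale0r.
Qed.

Lemma hip_tens n (z : 'M[H]_n) b : hip z (tens b) = fdot (pair_e z) b.
Proof.
rewrite fdotE; apply: eq_bigr => i _; apply: eq_bigr => j _.
by rewrite !mxE ipZr mulrC.
Qed.

Lemma lract_tens n m (a : 'M[C]_(m, n)) (b : 'M[C]_n) (c : 'M[C]_(n, m)) :
  lact a (ract (tens b) c) = tens (a *m b *m c).
Proof.
apply/matrixP=> i j; rewrite -mulmxA !mxE scaler_suml; apply: eq_bigr => k _.
rewrite -scalerA !mxE scaler_suml; congr (_ *: _); apply: eq_bigr => l _.
by rewrite !mxE scalerA mulrC.
Qed.

Lemma qf_tensl n m (a : 'M[C]_n) (x : 'M[H]_m) u v :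
  qf (tens a) x u v = fdot (u^h *m a *m v) (pair_e x).
Proof. by rewrite /qform lract_tens -hip_conj hip_tens -fdotC. Qed.

Lemma qf_tensr n m (z : 'M[H]_n) (b : 'M[C]_m) u v :
  qf z (tens b) u v = fdot (pair_e z) (u *m b *m v^h).
Proof. by rewrite qf_sym qf_tensl -fdotC ctransK. Qed.

Lemma pair_eD n (y z : 'M[H]_n) : pair_e (y + z) = pair_e y + pair_e z.
Proof. by apply/matrixP=> i j; rewrite !mxE ipDl. Qed.

Lemma pair_eN n (z : 'M[H]_n) : pair_e (- z) = - pair_e z.
Proof. by apply/matrixP=> i j; rewrite !mxE -scaleN1r ipZl mulN1r. Qed.

Lemma pair_eZ n c (z : 'M[H]_n) : pair_e (scalemxH c z) = c *: pair_e z.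
Proof. by apply/matrixP=> i j; rewrite !mxE ipZl. Qed.

Lemma pair_e_tens n (a : 'M[C]_n) : pair_e (tens a) = a.
Proof. by apply/matrixP=> i j; rewrite !mxE ipZl e_unit mulr1. Qed.

Lemma pair_e_emx n : pair_e (emx n) = 1%:M.
Proof. by rewrite emxE pair_e_tens. Qed.

Lemma pair_e_lract n m (a : 'M[C]_(m, n)) (z : 'M[H]_n) (b : 'M[C]_(n, m)) :
  pair_e (lact a (ract z b)) = a *m pair_e z *m b.
Proof.
apply/matrixP=> i j; rewrite -mulmxA !mxE ip_suml; apply: eq_bigr => k _.
rewrite ipZl !mxE ip_suml; congr (_ * _); apply: eq_bigr => l _.
by rewrite !mxE ipZl mulrC.
Qed.

Lemma pair_e_herm n (z : 'M[H]_n) : herm z -> (pair_e z)^h = pair_e z.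
Proof.
move=> hz; apply/matrixP=> i j; rewrite !mxE -star_ip e_herm.
by move/matrixP/(_ i j): hz; rewrite mxE => ->.
Qed.

Lemma herm_tens n (a : 'M[C]_n) : a^h = a -> herm (tens a).
Proof.
move=> ha; apply/matrixP=> i j; rewrite !mxE starZ e_herm.
by move/matrixP/(_ i j): ha; rewrite !mxE => ->.
Qed.

Lemma herm_emx n : herm (emx n).
Proof. by rewrite emxE; apply: herm_tens; rewrite ctrans1. Qed.

Lemma hermD n (y z : 'M[H]_n) : herm y -> herm z -> herm (y + z).
Proof. by rewrite /Defs.herm mstarD => -> ->. Qed.

Lemma hermZ n c (z : 'M[H]_n) : c \is Num.real -> herm z -> herm (scalemxH c z).
Proof. by rewrite /Defs.herm mstarZ => /CrealP-> ->. Qed.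

Lemma scalemxHN1 n (z : 'M[H]_n) : scalemxH (-1) z = - z.
Proof. by apply/matrixP=> i j; rewrite !mxE scaleN1r. Qed.

Lemma hermB n (y z : 'M[H]_n) : herm y -> herm z -> herm (y - z).
Proof. by move=> hy hz; rewrite -scalemxHN1; apply: hermD (hermZ _ hz); rewrite ?rpredN1. Qed.

Lemma qf_emx n m (x : 'M[H]_m) u v :
  pair_e x = 1%:M -> qf (emx n) x u v = fdot v u.
Proof.
by move=> x1; rewrite emxE qf_tensl x1 /fdot ctrans1 !mulmx1 mxtrace_mulC.
Qed.

Lemma qbounded_emx n : qbounded (emx n) (emx n) (1 ^+ 2).
Proof.
move=> u v; rewrite qf_emx ?pair_e_emx // expr1n mul1r mulrC.
exact: fdot_CauchySchwarz.
Qed.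

Lemma BehZ n c (z : 'M[H]_n) : c \is Num.real -> herm z -> pair_e z = 0 ->
  `|c| * onorm z <= 1 -> Beh (scalemxH c z).
Proof.
move=> c_real hz z0 c1; split; first exact: hermZ.
split; first by rewrite pair_eZ z0 scaler0.
apply/onorm_leP => // u v; rewrite qfZl qfZr !normrM norm_conjC mulrA -expr2.
apply: le_trans (_ : `|c| ^+ 2 * (onorm z ^+ 2 * fnorm u * fnorm v) <= _).
  by rewrite ler_wpM2l ?exprn_ge0 // onorm_qbounded.
have -> : `|c| ^+ 2 * (onorm z ^+ 2 * fnorm u * fnorm v)
  = (`|c| * onorm z) ^+ 2 * fnorm u * fnorm v by ring.
rewrite !ler_wpM2r ?fnorm_ge0 //.
by rewrite ler_sqr ?nnegrE ?mulr_ge0 ?onorm_ge0.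
Qed.

Lemma BehN n (z : 'M[H]_n) : Beh z -> Beh (- z).
Proof.
move=> [hz [z0 z1]]; rewrite -scalemxHN1.
by apply: BehZ; rewrite ?rpredN1 ?normrN1 ?mul1r.
Qed.

Lemma Beh0 n : Beh (0 : 'M[H]_n).
Proof.
have -> : 0 = scalemxH 0 0 :> 'M[H]_n.
  by apply/matrixP=> i j; rewrite !mxE scaler0.
apply: BehZ; rewrite ?normr0 ?mul0r ?ler01 //.
  by apply/matrixP=> i j; rewrite !mxE star0.
by apply/matrixP=> i j; rewrite !mxE ip0l.
Qed.

Lemma Beh_state n (eta : 'M[H]_n) : Beh eta -> pair_e (eta + emx n) = 1%:M.
Proof. by move=> [_ [eta0 _]]; rewrite pair_eD eta0 pair_e_emx add0r. Qed.

Lemma Beh_herm n (eta : 'M[H]_n) : Beh eta -> herm (eta + emx n).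
Proof. by move=> [heta _]; apply: hermD (herm_emx n). Qed.

Lemma qfNr n m (z : 'M[H]_n) (x : 'M[H]_m) u v : qf z (- x) u v = - qf z x u v.
Proof. by rewrite -scalemxHN1 qfZr rmorphN1 mulN1r. Qed.

Lemma qfNl n m (z : 'M[H]_n) (x : 'M[H]_m) u v : qf (- z) x u v = - qf z x u v.
Proof. by rewrite -scalemxHN1 qfZl mulN1r. Qed.

Lemma CoP n (z : 'M[H]_n) : Co z <-> herm z /\
  (forall m (eta : 'M[H]_m), Beh eta -> forall u, 0 <= qf z (eta + emx m) u u).
Proof.
by split=> -[hz P]; split=> // m eta /P /psd_pairingP.
Qed.

(* Test z against the normalization of z itself. *)
Lemma onorm_le_dual n (z : 'M[H]_n) r : 0 <= r -> herm z -> pair_e z = 0 ->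
  (forall eta : 'M[H]_n, Beh eta -> forall u, `|qf z eta u u| <= r * fdot u u) ->
  onorm z <= r.
Proof.
move=> r_ge0 hz z0 P; have := onorm_ge0 z; rewrite le0r => /predU1P[-> //|s_gt0].
have s_real : (onorm z)^-1 \is Num.real by rewrite realV gtr0_real.
have s_norm : `|(onorm z)^-1| = (onorm z)^-1 by rewrite ger0_norm // invr_ge0 ltW.
have B : Beh (scalemxH (onorm z)^-1 z).
  by apply: BehZ => //; rewrite s_norm mulVf ?gt_eqF.
suff : qbounded z z (r * onorm z).
  move/opnorm_pairingP; rewrite -onormK expr2 ler_pM2r //; apply.
  by rewrite mulr_ge0 // ltW.
apply: qbounded_diag => // [|u]; first by rewrite mulr_ge0 // ltW.
have := P _ B u; rewrite qfZr normrM norm_conjC s_norm -ler_pdivlMl ?invr_gt0 //.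
by rewrite invrK mulrA [r * _]mulrC.
Qed.

(** Since <<eta, e>> = 0, eta sees only the part of z orthogonal to e, while the summand e^(m) sees
    only <<z, e>>. *)
Lemma qf_split n m (z : 'M[H]_n) (eta : 'M[H]_m) u v : Beh eta ->
  qf z (eta + emx m) u v
  = qf (z - tens (pair_e z)) eta u v + fdot (pair_e z) (u *m v^h).
Proof.
move=> [_ [eta0 _]]; rewrite qfDl qfNl qf_tensl eta0.
rewrite fdot0r subr0.
by rewrite qfDr emxE qf_tensr mulmx1.
Qed.

Lemma pair_e_perp n (z : 'M[H]_n) : pair_e (z - tens (pair_e z)) = 0.
Proof. by rewrite pair_eD pair_eN pair_e_tens subrr. Qed.

(** By [qf_split] the form of z at a state is that of z - r e at eta, plus r |u|^2. As [Beh] is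
    stable under eta -> -eta, positivity bounds the former in absolute value by r |u|^2, and
    [onorm_le_dual] applies. The converse is Haagerup's inequality with ||eta||_o <= 1. *)
Lemma Co_scalarP n (z : 'M[H]_n) r : herm z -> pair_e z = r%:M -> 0 <= r ->
  Co z <-> onorm (z - tens r%:M) <= r.
Proof.
move=> hz zr r_ge0; have hy : herm (z - tens r%:M).
  by apply: hermB => //; apply: herm_tens; rewrite -zr pair_e_herm.
have y0 : pair_e (z - tens r%:M) = 0 by rewrite -zr pair_e_perp.
have qfE m (eta : 'M[H]_m) u : Beh eta ->
    qf z (eta + emx m) u u = qf (z - tens r%:M) eta u u + r * fdot u u.
  move=> B; rewrite qf_split // zr; congr (_ + _).
  by rewrite /fdot mul_scalar_mx linearZ ctransM ctransK.
rewrite CoP; split=> [[_ P]|yr].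
  apply: onorm_le_dual => // eta B u; have [heta _] := B.
  rewrite real_norm_le ?qf_real // -qfE // P //=.
  by have := P _ _ (BehN B) u; rewrite qfE ?qfNr 1?addrC //; apply: BehN.
split=> // m eta B u; rewrite qfE //; have [heta [_ eta1]] := B.
have : `|qf (z - tens r%:M) eta u u| <= r * fdot u u.
  have := Haagerup_CauchySchwarz r_ge0 ler01 _ _ u u.
  rewrite mulr1 -mulrA -expr2 fnormK; apply; first exact/onorm_leP.
  exact/onorm_leP.
by rewrite real_norm_le ?qf_real // => /andP[].
Qed.

(** The case r = 1: the states that define the cone lie in it, and it has no other normalized
    elements. *)
Lemma Co_stateP n (z : 'M[H]_n) : pair_e z = 1%:M -> Co z <-> Beh (z - emx n).
Proof.
move=> z1; split=> [Cz|Bz].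
  have [hz _] := Cz; split; first exact: hermB (herm_emx n).
  rewrite emxE; split; first by rewrite -z1 pair_e_perp.
  exact/Co_scalarP.
have hz : herm z by rewrite -[z](subrK (emx n)); apply: Beh_herm.
by apply/(Co_scalarP hz z1) => //; rewrite -emxE; case: Bz => _ [].
Qed.

Lemma Co_Beh n (eta : 'M[H]_n) : Beh eta -> Co (eta + emx n).
Proof. by move=> B; apply/Co_stateP; rewrite ?Beh_state ?addrK. Qed.

Lemma CoD n (y z : 'M[H]_n) : Co y -> Co z -> Co (y + z).
Proof.
rewrite !CoP => -[hy Py] [hz Pz]; split; first exact: hermD.
by move=> m eta B u; rewrite qfDl addr_ge0 ?Py ?Pz.
Qed.

Lemma Co_congr n m (a : 'M[C]_(n, m)) z : Co z -> Co (congr_act a z).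
Proof.
rewrite !CoP => -[hz Pz]; split.
  by rewrite congr_actE /Defs.herm mstar_lact mstar_ract ctransK hz lract_comm.
by move=> k eta B u; rewrite qf_congr_act Pz.
Qed.

Lemma Co_unital n (z : 'M[H]_n) r : herm z -> 2 * onorm z <= r ->
  Co (z + scalemxH r (emx n)).
Proof.
move=> hz le_r; have r_ge0 : 0 <= r.
  by apply: le_trans le_r; rewrite mulr_ge0 ?onorm_ge0.
apply/CoP; split.
  by apply: hermD => //; apply: hermZ (herm_emx n); apply: ger0_real.
move=> m eta B u; rewrite qfDl qfZl qf_emx ?Beh_state //.
have : `|qf z (eta + emx m) u u| <= r * fdot u u.
  (* The constant 2 is the bound 1 + 1 for the norm of a state eta + e^(m). *)
  apply: le_trans (_ : 2 * onorm z * fdot u u <= _).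
    have := Haagerup_CauchySchwarz (onorm_ge0 z) (addr_ge0 ler01 ler01)
      (onorm_qbounded z) _ u u.
    rewrite -mulrA -expr2 fnormK [2 * _]mulrC; apply.
    apply: qboundedD => //; last exact: qbounded_emx.
    by apply/onorm_leP => //; case: B => _ [].
  by rewrite ler_wpM2r ?fdot_ge0.
rewrite real_norm_le; first by case/andP.
by apply: qf_real => //; apply: Beh_herm.
Qed.


(** * Whitening, self-duality and matricial states *)

Lemma pair_e_psd n (z : 'M[H]_n) : Co z -> psd (pair_e z).
Proof.
(* Testing against e itself, the state with eta = 0 and m = 1. *)
case/CoP=> _ P v; have := P 1%N 0 (Beh0 1) v.
rewrite add0r emxE qf_tensr mulmx1 /fdot ctransM ctransK mulmxA mxtrace_mulC.
by rewrite mulmxA /mxtrace big_ord1.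
Qed.

Lemma pair_e_congr n m (a : 'M[C]_(n, m)) z :
  pair_e (congr_act a z) = a^h *m pair_e z *m a.
Proof. by rewrite congr_actE pair_e_lract. Qed.

Lemma congr_actM n m k (a : 'M[C]_(n, m)) (b : 'M[C]_(m, k)) (z : 'M[H]_n) :
  congr_act b (congr_act a z) = congr_act (a *m b) z.
Proof. by rewrite !congr_actE lract_comm lactM ractM ctransM. Qed.

Lemma Co_scale_emx n r : 0 <= r -> Co (scalemxH r (emx n)).
Proof.
move=> r_ge0; apply/CoP; split.
  by apply: hermZ (herm_emx n); apply: ger0_real.
by move=> m eta B u; rewrite qfZl qf_emx ?Beh_state // mulr_ge0 ?fdot_ge0.
Qed.

(* Congruence by the inverse square root of <<z, e>> + r normalizes z to a state. *)
Lemma Co_whitening n (z : 'M[H]_n) r : Co z -> 0 < r ->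
  exists s : 'M[C]_n, exists2 eta : 'M[H]_n, Beh eta
    & z + scalemxH r (emx n) = congr_act s (eta + emx n).
Proof.
move=> Cz r_gt0; have [hz _] := Cz.
have [t [s [tt ts]]] := pos_whitening (pair_e_herm hz) (pair_e_psd Cz) r_gt0.
set z' := z + _; have Cw : Co (congr_act t z').
  by apply: Co_congr; apply: CoD => //; apply: Co_scale_emx; apply: ltW.
exists s, (congr_act t z' - emx n).
  apply/Co_stateP => //; rewrite pair_e_congr -tt; congr (_ *m _ *m _).
  by rewrite pair_eD pair_eZ pair_e_emx scalemx1.
by rewrite subrK congr_actM ts congr_actE ctrans1 ract1 lact1.
Qed.

(** After the flip, x is nonnegative against all states, hence against their congruences. By
    whitening these include z + r e for every r > 0, and r is then removed. *)
Lemma Co_selfpolar n m (z : 'M[H]_n) (x : 'M[H]_m) u :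
  Co z -> Co x -> 0 <= qf z x u u.
Proof.
move=> Cz /CoP[hx Px].
have state k (eta : 'M[H]_k) v : Beh eta -> 0 <= qf (eta + emx k) x v v.
  by move=> B; rewrite qf_sym conjC_ge0 Px.
apply: (@ge0_of_perturbation _ _ (qf (emx n) x u u)).
  by have := state n 0 u (Beh0 n); rewrite add0r.
move=> r r_gt0; have [s [eta B E]] := Co_whitening Cz r_gt0.
by rewrite -qfZl -qfDl E qf_congr_act state.
Qed.

Lemma CobarP n (x : 'M[H]_n) : Cobar HS e x <-> Co x.
Proof.
rewrite CoP; split=> -[hx P]; split=> // m eta B; last first.
  by apply/psd_pairingP=> u; rewrite qf_sym conjC_ge0 P.
by move=> u; rewrite qf_sym conjC_ge0; move/psd_pairingP: (P m eta B); apply.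
Qed.

Lemma qpolar_CoP n (x : 'M[H]_n) : qpolar HS Co x <-> Co x.
Proof.
split=> [[hx P]|Cx].
  apply/CobarP; split=> // m eta B; apply: P; exact: Co_Beh.
split=> [|m z Cz]; first by case: Cx.
by apply/psd_pairingP=> u; apply: Co_selfpolar.
Qed.

Lemma qpolar_bar_CobarP n (z : 'M[H]_n) : qpolar_bar HS (Cobar HS e) z <-> Co z.
Proof.
split=> [[hz P]|Cz].
  by split=> // m eta B; apply: P; apply/CobarP; apply: Co_Beh.
split=> [|m x /CobarP Cx]; first by case: Cz.
by apply/psd_pairingP=> u; apply: Co_selfpolar.
Qed.

Lemma e_pairE n (x : 'M[H]_n) : herm x -> e_pair HS e x = 1%:M <-> pair_e x = 1%:M.
Proof.
move=> hx; have -> : e_pair HS e x = (pair_e x)^T.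
  apply/matrixP=> i j; rewrite !mxE -ip_conj -star_ip e_herm.
  by move/matrixP/(_ j i): hx; rewrite mxE => ->.
by split=> [/(congr1 trmx)|->]; rewrite ?trmxK ?trmx1.
Qed.

Lemma matricial_statesP n (x : 'M[H]_n) :
  (qpolar HS Co x /\ e_pair HS e x = 1%:M) <->
  (exists eta : 'M[H]_n, Beh eta /\ x = eta + emx n).
Proof.
rewrite qpolar_CoP; split=> [[Cx]|[eta [B ->]]].
  have [hx _] := Cx; move/(e_pairE hx) => x1.
  by exists (x - emx n); rewrite subrK; split=> //; apply/Co_stateP.
split; first exact: Co_Beh.
by apply/e_pairE; [exact: Beh_herm | exact: Beh_state].
Qed.

(** * Bounds on all states, free of suprema, and the comparison of ||.||_e with ||.||_o *)

Definition state_bounded n (z : 'M[H]_n) r :=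
  forall m (eta : 'M[H]_m), Beh eta -> qbounded z (eta + emx m) r.

Lemma state_bounded_mul n (z : 'M[H]_n) r m (v : 'M[C]_(n, m)) : 0 <= r ->
  state_bounded z r -> fnorm (pair_e z *m v) <= r * fnorm v.
Proof.
(* With eta = 0 and a = <<z, e>>, testing u = a v gives |a v|^2 <= r |a v| |v|. *)
move=> r_ge0 /(_ m 0 (Beh0 m)); rewrite add0r => /(_ (pair_e z *m v) v).
rewrite emxE qf_tensr mulmx1 /fdot ctransM ctransK mulmxA -/(fdot _ _).
rewrite -fnormK ger0_norm ?exprn_ge0 ?fnorm_ge0 // expr2 mulrAC.
have := fnorm_ge0 (pair_e z *m v); rewrite le0r => /predU1P[->|gt0].
  by rewrite mulr_ge0 ?fnorm_ge0.
by rewrite ler_pM2r.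
Qed.

(** The part of z orthogonal to e and the part a (x) e each have norm at most r, and the triangle
    inequality gives 2 r. *)
Lemma state_bounded_herm n (z : 'M[H]_n) r : 0 <= r -> herm z ->
  state_bounded z r -> qbounded z z ((2 * r) ^+ 2).
Proof.
move=> r_ge0 hz P; pose a := pair_e z.
have ha : a^h = a by apply: pair_e_herm.
have -> : z = (z - tens a) + tens a by rewrite subrK.
have hy : herm (z - tens a) by apply: hermB (herm_tens ha).
rewrite [2 * r]mulr_natl mulr2n; apply: qboundedD => //.
  apply/onorm_leP => //; apply: onorm_le_dual; rewrite ?pair_e_perp //.
  move=> eta B u; have [heta _] := B.
  have P1 := P _ _ B u u; have P2 := P _ _ (BehN B) u u.
  rewrite qf_split // in P1; rewrite qf_split ?qfNr in P2; last exact: BehN.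
  (* The states of eta and -eta share the scalar term, so their difference is twice the form of the
     orthogonal part. *)
  have := le_trans (ler_normB _ _) (lerD P1 P2).
  rewrite opprD opprK addrACA subrr addr0 -!mulr2n normrMn lerMn2r /=.
  by rewrite -mulrA -expr2 fnormK.
move=> u v; rewrite qf_tensl pair_e_tens.
(* Regrouped so that the bound r for multiplication by a can be used twice. *)
have -> : fdot (u^h *m a *m v) a = fdot (a *m (a *m v)^h)^h u.
  by rewrite ctransM ctransK /fdot -!mulmxA mxtrace_mulC !mulmxA.
apply: le_trans (fdot_CauchySchwarz _ _) _; rewrite fnorm_ctrans mulrAC.
rewrite ler_wpM2r ?fnorm_ge0 //.
apply: le_trans (state_bounded_mul _ r_ge0 P) _.
by rewrite fnorm_ctrans expr2 -mulrA ler_wpM2l // state_bounded_mul.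
Qed.

Lemma state_boundedZ n (z : 'M[H]_n) c r :
  state_bounded z r -> state_bounded (scalemxH c z) (`|c| * r).
Proof.
by move=> P m eta B u v; rewrite qfZl normrM -!mulrA ler_wpM2l // mulrA P.
Qed.

Lemma state_boundedD n (y z : 'M[H]_n) r s :
  state_bounded y r -> state_bounded z s -> state_bounded (y + z) (r + s).
Proof.
move=> Py Pz m eta B u v; rewrite qfDl !mulrDl.
by apply: le_trans (ler_normD _ _) (lerD (Py _ _ B _ _) (Pz _ _ B _ _)).
Qed.

Lemma state_bounded_mstar n (z : 'M[H]_n) r :
  state_bounded z r -> state_bounded (mstar z) r.
Proof.
move=> P m eta B u v; rewrite -(Beh_herm B) qf_mstar norm_conjC mulrAC.
exact: P.
Qed.

(** The real and imaginary parts h and k of z = h + i k inherit the bound r on states. Being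
    hermitian, each has norm at most 2 r. *)
Lemma state_bounded_onorm n (z : 'M[H]_n) r : 0 <= r ->
  state_bounded z r -> onorm z <= 4 * r.
Proof.
move=> r_ge0 P; pose h := scalemxH (2^-1) (z + mstar z).
pose k := scalemxH (2^-1 * 'i) (mstar z - z).
have zE : z = h + scalemxH 'i k.
  apply/matrixP=> i j; rewrite !mxE scalerA mulrCA -expr2 sqrCi mulrN1 scaleNr.
  rewrite -scalerN opprB -scalerDr addrACA subrr addr0 -mulr2n -scaler_nat.
  by rewrite scalerA mulVf ?scale1r // pnatr_eq0.
have half : 2^-1 * (r + r) = r by field; rewrite ?pnatr_eq0.
have Pstar := state_bounded_mstar P.
have n2 : `|2^-1| = 2^-1 :> C by rewrite ger0_norm // invr_ge0.
have Ph : qbounded h h ((2 * r) ^+ 2).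
  apply: state_bounded_herm => //.
    apply: hermZ; first by rewrite realV realn.
    by rewrite /Defs.herm mstarD mstarK addrC.
  by rewrite -half -[X in X * _]n2; apply: state_boundedZ (state_boundedD _ _).
have Pk : qbounded k k ((2 * r) ^+ 2).
  apply: state_bounded_herm => //.
    rewrite /k /Defs.herm mstarZ rmorphM /= conjCi -scalemxHN1 mstarD mstarZ mstarK.
    rewrite fmorphV rmorph_nat rmorphN1 !scalemxHN1; apply/matrixP=> i j.
    by rewrite !mxE mulrN scaleNr -scalerN opprB.
  rewrite -half -[X in X * _]n2.
  have -> : `|2^-1| = `|2^-1 * 'i| :> C by rewrite normrM normCi mulr1.
  apply: state_boundedZ; apply: state_boundedD => //.
  by have := state_boundedZ (-1) P; rewrite scalemxHN1 normrN1 mul1r.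
apply/onorm_leP; first by rewrite mulr_ge0.
have -> : 4 * r = 2 * r + 2 * r by ring.
rewrite [in X in qbounded X _]zE [in X in qbounded _ X]zE.
apply: qboundedD; rewrite ?mulr_ge0 // => u v.
rewrite qfZl qfZr mulrA -normCK normCi expr1n mul1r; exact: Pk.
Qed.

Lemma state_bounded_2onorm n (z : 'M[H]_n) : state_bounded z (2 * onorm z).
Proof.
move=> m eta B u v; rewrite [2 * _]mulrC.
apply: Haagerup_CauchySchwarz; rewrite ?onorm_ge0 //; first exact: onorm_qbounded.
by apply: qboundedD; [| |case: B => _ [_ /onorm_leP]; apply| exact: qbounded_emx].
Qed.

Local Notation enorm := (enorm HS e).

Lemma enorm_lub n (z : 'M[H]_n) :
  is_lub (fun r => exists m (eta : 'M[H]_m),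
    Beh eta /\ r = opnorm (pairing HS z (eta + emx m))) (enorm z).
Proof.
apply: (epsilon_spec (inhabits 0)); apply: hC.
- by move=> x [m [eta [_ ->]]]; rewrite ger0_real // opnorm_ge0.
- by exists (opnorm (pairing HS z (0 + emx 0))), 0%N, 0; split=> //; apply: Beh0.
have ge0 : 0 <= 2 * onorm z by rewrite mulr_ge0 // onorm_ge0.
exists (2 * onorm z); split; first exact: ger0_real.
by move=> x [m [eta [B ->]]]; apply/opnorm_pairingP => //; apply: state_bounded_2onorm.
Qed.

Lemma enorm_ge0 n (z : 'M[H]_n) : 0 <= enorm z.
Proof.
have [_ [ub _]] := enorm_lub z.
apply: le_trans (opnorm_ge0 hC (pairing HS z (0 + emx 0))) (ub _ _).
by exists 0%N, 0; split=> //; apply: Beh0.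
Qed.

Lemma enorm_leP n (z : 'M[H]_n) r : 0 <= r -> enorm z <= r <-> state_bounded z r.
Proof.
move=> r_ge0; have [_ [ub lub]] := enorm_lub z; split=> [le_r m eta B|P].
  apply/opnorm_pairingP => //; apply: le_trans le_r; apply: ub.
  by exists m, eta.
apply: lub => [|x [m [eta [B ->]]]]; first exact: ger0_real.
by apply/opnorm_pairingP => //; apply: P.
Qed.

(** * Block matrices and the order unit norm *)

Lemma lact_row_col p n1 n2 m (a : 'M[C]_(p, n1)) (b : 'M[C]_(p, n2))
    (y : 'M[H]_(n1, m)) (z : 'M[H]_(n2, m)) :
  lact (row_mx a b) (col_mx y z) = lact a y + lact b z.
Proof.
apply/matrixP=> i j; rewrite !mxE big_split_ord; congr (_ + _);
  apply: eq_bigr => k _.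
  by rewrite row_mxEl col_mxEu.
by rewrite row_mxEr col_mxEd.
Qed.

Lemma ract_row_col p n1 n2 m (y : 'M[H]_(p, n1)) (z : 'M[H]_(p, n2))
    (a : 'M[C]_(n1, m)) (b : 'M[C]_(n2, m)) :
  ract (row_mx y z) (col_mx a b) = ract y a + ract z b.
Proof.
apply/matrixP=> i j; rewrite !mxE big_split_ord; congr (_ + _);
  apply: eq_bigr => k _.
  by rewrite row_mxEl col_mxEu.
by rewrite row_mxEr col_mxEd.
Qed.

Lemma ract_col_mx n1 n2 m q (y : 'M[H]_(n1, m)) (z : 'M[H]_(n2, m))
    (a : 'M[C]_(m, q)) :
  ract (col_mx y z) a = col_mx (ract y a) (ract z a).
Proof.
apply/matrixP=> i j; rewrite !mxE; case: splitP => k ik; rewrite !mxE;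
  apply: eq_bigr => l _.
  by have -> : i = lshift n2 k; [apply: val_inj|rewrite col_mxEu].
by have -> : i = rshift n1 k; [apply: val_inj|rewrite col_mxEd].
Qed.

Lemma qf_block n m (w x y z : 'M[H]_n) (t : 'M[H]_m) u1 u2 v1 v2 :
  qf (block_mx w x y z) t (col_mx u1 u2) (col_mx v1 v2)
  = qf w t u1 v1 + qf x t u1 v2 + (qf y t u2 v1 + qf z t u2 v2).
Proof.
rewrite /qform; have -> : (col_mx u1 u2)^h = row_mx u1^h u2^h.
  by rewrite /ctrans map_col_mx tr_col_mx.
by rewrite ract_col_mx !ract_row_col lact_row_col !lactDr !hipDl.
Qed.

Lemma herm_block n (z : 'M[H]_n) r : r \is Num.real ->
  herm (block_mx (scalemxH r (emx n)) z (mstar z) (scalemxH r (emx n))).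
Proof.
move=> r_real; have he := hermZ r_real (herm_emx n).
have mstar_block (w x y t : 'M[H]_n) :
    mstar (block_mx w x y t)
    = block_mx (mstar w) (mstar y) (mstar x) (mstar t).
  have -> : forall p q (A : 'M[H]_(p, q)), mstar A = (map_mx star A)^T.
    by move=> p q A; apply/matrixP=> i j; rewrite !mxE.
  by rewrite map_block_mx tr_block_mx /Defs.mstar; congr block_mx;
    apply/matrixP=> i j; rewrite !mxE.
by rewrite /Defs.herm mstar_block he mstarK.
Qed.

(** Against a state, the diagonal blocks contribute r (|u|^2 + |v|^2) and the others twice the real
    part of the form of z at (u, v). The discriminant criterion gives one direction, 2 |u| |v| <=
    |u|^2 + |v|^2 the other. *)
Lemma Co_blockP n (z : 'M[H]_n) r : 0 < r ->
  Co (block_mx (scalemxH r (emx n)) z (mstar z) (scalemxH r (emx n)))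
  <-> state_bounded z r.
Proof.
move=> r_gt0; have r_ge0 := ltW r_gt0.
have qfE m (eta : 'M[H]_m) u v : Beh eta ->
    qf (block_mx (scalemxH r (emx n)) z (mstar z) (scalemxH r (emx n)))
      (eta + emx m) (col_mx u v) (col_mx u v)
    = r * (fdot u u + fdot v v) + qf z (eta + emx m) u v
      + (qf z (eta + emx m) u v)^*.
  move=> B; rewrite qf_block !qfZl !qf_emx ?Beh_state //.
  rewrite -{2}(Beh_herm B) qf_mstar; ring.
rewrite CoP; split=> [[_ P] m eta B|P].
  by apply: qbounded_discriminant => // u v; rewrite -qfE // P.
split; first by apply: herm_block; apply: gtr0_real.
move=> m eta B w; rewrite -[w]vsubmxK qfE //.
move: (usubmx w) (dsubmx w) => u v; have := P _ _ B u v.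
set q := qf _ _ u v => le_q.
have ru : fnorm u * fnorm v *+ 2 <= fdot u u + fdot v v.
  rewrite -!fnormK -subr_ge0.
  have -> : fnorm u ^+ 2 + fnorm v ^+ 2 - fnorm u * fnorm v *+ 2
    = (fnorm u - fnorm v) ^+ 2 by rewrite sqrrB addrAC.
  by rewrite real_exprn_even_ge0 // realB // ger0_real // fnorm_ge0.
have req : q + q^* \is Num.real by apply/CrealP; rewrite rmorphD /= conjCK addrC.
have : `|q + q^*| <= r * (fdot u u + fdot v v).
  apply: le_trans (ler_normD _ _) _; rewrite norm_conjC -mulr2n.
  apply: le_trans (_ : r * (fnorm u * fnorm v *+ 2) <= _).
    by rewrite mulrnAr lerMn2r mulrA.
  by rewrite ler_wpM2l.
by rewrite real_norm_le // => /andP[+ _]; rewrite addrC addrA.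
Qed.

Lemma ounormE n (z : 'M[H]_n) : ounorm HS e Co z = enorm z.
Proof.
apply: cinf_eq; split; first by rewrite ger0_real // enorm_ge0.
split=> [r [r_gt0 /(Co_blockP _ r_gt0) P]|b b_real P].
  by apply/enorm_leP => //; apply: ltW.
(* The infimum runs over strictly positive numbers while ||z||_e may vanish, so it is approached
   through ||z||_e + r. *)
rewrite -subr_ge0; apply: (@ge0_of_perturbation _ _ 1) => // r r_gt0.
rewrite mulr1 addrAC subr_ge0; apply: P.
have gt0 : 0 < enorm z + r by rewrite ltr_wpDl // enorm_ge0.
split=> //; apply/Co_blockP => //; apply/enorm_leP; first exact: ltW.
by rewrite lerDl ltW.
Qed.

(** * Archimedean property, separation and the cone at level one *)

Lemma Co_archimedean : archimedean e Co.
Proof.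
move=> n z P; apply/CoP; split.
  have [hz _] := P 1 ltr01.
  rewrite -[z](addrK (scalemxH 1 (emx n))); apply: hermB hz _.
  by apply: hermZ (herm_emx n); apply: real1.
move=> m eta B u; apply: (@ge0_of_perturbation _ _ (fdot u u)); first exact: fdot_ge0.
move=> r /P /CoP[_ /(_ m eta B u)].
by rewrite qfDl qfZl qf_emx ?Beh_state.
Qed.

(** The diagonal matrix units at i and j, as test matrices, isolate the squared norm of the entry
    z_ij. *)
Lemma qbounded0_eq0 n (z : 'M[H]_n) : qbounded z z 0 -> z = 0.
Proof.
move=> P; apply/matrixP=> i j; rewrite mxE; apply/eqP; apply: contraT.
move/(ip_posdef HS); have := P (delta_mx i i) (delta_mx j j).
rewrite !mul0r normr_le0 => /eqP; rewrite /qform /hdot.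
rewrite (bigD1 i) //= (bigD1 j) //= !big1 ?addr0.
- rewrite mxE (bigD1 i) //= big1 ?addr0 => [|k /negPf ki]; last first.
    by rewrite !mxE ki rmorph0 scale0r.
  rewrite !mxE (bigD1 j) //= big1 ?addr0 => [|k /negPf kj]; last first.
    by rewrite !mxE kj scale0r.
  by rewrite !mxE !eqxx rmorph1 !scale1r => ->; rewrite ltxx.
- move=> k /negPf ki; rewrite big1 // => l _; rewrite mxE big1 ?ip0l // => p _.
  by rewrite !mxE ki andbF rmorph0 scale0r.
move=> l /negPf lj; rewrite mxE big1 ?ip0l // => p _.
rewrite [ract _ _ _ _]mxE big1 ?scaler0 // => k _.
by rewrite !mxE lj andbF scale0r.
Qed.

(** If x and -x are both in the cone, the form of x vanishes on the diagonal for every state. Thus x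
    is bounded by 0 on states, and [state_bounded_herm] makes its norm 0. *)
Lemma Co_separated : separated Co.
Proof.
move=> n x /CoP[hx P1] /CoP[_ P2]; apply: qbounded0_eq0.
have -> : 0 = (2 * 0) ^+ 2 :> C by rewrite mulr0 expr0n.
apply: state_bounded_herm => // m eta B; apply: qbounded_diag => //.
  exact: Beh_herm.
move=> u; rewrite mul0r normr_le0; apply/eqP/le_anti; rewrite P1 // andbT.
by have := P2 _ _ B u; rewrite qfNl oppr_ge0.
Qed.

Lemma qf_mx11 (z x : 'M[H]_1) u v :
  qf z x u v = (u 0 0)^* * v 0 0 * ip (z 0 0) (x 0 0).
Proof.
rewrite /qform /hdot !big_ord1 mxE big_ord1 [ract _ _ _ _]mxE big_ord1 !mxE.
by rewrite !ipZl mulrA.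
Qed.

Lemma fnorm_mx11 (u : 'M[C]_1) : fnorm u = `|u 0 0|.
Proof. by rewrite normC_def /fnorm fdotE !big_ord1. Qed.

Lemma onorm_mx11_le (y : 'M[H]_1) r : 0 <= r ->
  onorm y <= r <-> ip (y 0 0) (y 0 0) <= r ^+ 2.
Proof.
move=> r_ge0; rewrite onorm_leP //; split=> [/(_ 1%:M 1%:M)|le_r u v].
  rewrite qf_mx11 !fnorm_mx11 mxE eqxx normr1 rmorph1 !mul1r !mulr1.
  by rewrite ger0_norm ?ip_ge0.
rewrite qf_mx11 !fnorm_mx11 !normrM norm_conjC mulrC mulrA.
rewrite [`|ip _ _|]ger0_norm ?ip_ge0 //.
by rewrite !ler_wpM2r.
Qed.

Lemma Co1P (z : 'M[H]_1) : Co z <-> unital_cone_e HS e (z 0 0).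
Proof.
set a := ip (z 0 0) e.
have za : pair_e z = a%:M by apply/matrixP=> i j; rewrite !ord1 !mxE eqxx.
have hermE : herm z <-> star (z 0 0) = z 0 0.
  split=> [/matrixP/(_ 0 0)|hz]; first by rewrite mxE.
  by apply/matrixP=> i j; rewrite !ord1 mxE.
have a_real : herm z -> a \is Num.real.
  by move=> /hermE hz; apply/CrealP; rewrite -star_ip hz e_herm.
(* As e is a unit vector and a is real, ||z - a e||^2 = ||z||^2 - a^2; this is at most a^2 exactly
   when ||z||^2 <= 2 a^2. *)
have coneE : herm z -> 0 <= a ->
    (onorm (z - tens a%:M) <= a <-> hnorm HS (z 0 0) <= sqrtC 2 * a).
  move=> hz a_ge0; rewrite onorm_mx11_le //.
  have -> : (z - tens a%:M) 0 0 = z 0 0 + (- a) *: e.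
    by rewrite !mxE eqxx scaleNr.
  rewrite ipDl !ipDr !ipZl !ipZr -(ip_conj _ (z 0 0) e) -/a e_unit.
  rewrite rmorphN /= (CrealP (a_real hz)).
  rewrite -[X in _ <-> is_true X]ler_sqr ?nnegrE ?mulr_ge0 ?sqrtC_ge0 ?ip_ge0 //.
  rewrite exprMn !sqrtCK -[X in is_true X <-> _]subr_ge0.
  rewrite -[X in _ <-> is_true X]subr_ge0.
  suff -> : a ^+ 2 - (ip (z 0 0) (z 0 0) + - a * a + (- a * a + - a * (- a * 1)))
    = 2 * a ^+ 2 - ip (z 0 0) (z 0 0) by [].
  ring.
split=> [Cz|[/hermE hz le_a]].
  have [hz _] := Cz; have a_ge0 : 0 <= a.
    have /CoP[_ /(_ 1%N 0 (Beh0 1) 1%:M)] := Cz.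
    by rewrite add0r qf_mx11 !mxE eqxx rmorph1 !mul1r.
  split; first exact/hermE.
  by apply/coneE => //; apply/Co_scalarP.
have a_ge0 : 0 <= a.
  have : 0 <= sqrtC 2 * a by apply: le_trans le_a; rewrite sqrtC_ge0 ip_ge0.
  by rewrite pmulr_rge0 // sqrtC_gt0.
by apply/(Co_scalarP hz za a_ge0)/coneE.
Qed.

Lemma Co_quantum_cone : quantum_cone HS Co.
Proof.
by split=> [n x []|] //; split=> *; [apply: CoD | apply: Co_congr].
Qed.

End UnitalHilbert.

(** * Assembly of the theorem *)

Theorem mainTheorem8 (C : numClosedFieldType) (hC : complete_reals C)
  (H : lmodType C) (HS : hilbert_star H) (e : H)
  (e_herm : star HS e = e) (e_unit : ip HS e e = 1) :
  (* C_o is a separated unital quantum cone; with e it is an operator system *)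
  [/\ quantum_cone HS (Co HS e), separated (Co HS e), unital HS e (Co HS e)
    & archimedean e (Co HS e)] /\
  (* C_o cap M_1(H) = c_e *)
  (forall z : 'M[H]_1, Co HS e z <-> unital_cone_e HS e (z 0 0)) /\
  (* order-unit matrix norm = ||.||_e, equivalent to ||.||_o *)
  (forall n (z : 'M[H]_n), ounorm HS e (Co HS e) z = enorm HS e z) /\
  (forall n (z : 'M[H]_n),
     ounorm HS e (Co HS e) z / 2 <= onorm HS z /\
     onorm HS z <= 10 * ounorm HS e (Co HS e) z) /\
  (* matricial state space *)
  (forall n (x : 'M[H]_n),
     (qpolar HS (Co HS e) x /\ e_pair HS e x = 1%:M) <->
     (exists eta : 'M[H]_n, Beh HS e eta /\ x = eta + emx e n)) /\
  (* self-duality *)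
  (forall n (x : 'M[H]_n), qpolar HS (Co HS e) x <-> Cobar HS e x) /\
  (forall n (z : 'M[H]_n), qpolar_bar HS (Cobar HS e) z <-> Co HS e z).
Proof.
split; [split|split; [|split; [|split; [|split; [|split]]]]].
- exact: Co_quantum_cone.
- exact: Co_separated.
- move=> n x hx; have r_gt0 : 0 < 2 * onorm HS x + 1.
    by rewrite ltr_wpDl // mulr_ge0 // onorm_ge0.
  (* The summand 1 keeps the coefficient of e strictly positive when x = 0. *)
  by exists (2 * onorm HS x + 1); split=> //; apply: Co_unital; rewrite // lerDl.
- exact: Co_archimedean.
- exact: Co1P.
- by move=> n z; apply: ounormE.
- move=> n z; rewrite ounormE //; split.
    rewrite ler_pdivrMr // mulrC; apply/enorm_leP => //.
      by rewrite mulr_ge0 // onorm_ge0.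
    exact: state_bounded_2onorm.
  have ge0 : 0 <= enorm HS e z by apply: enorm_ge0.
  (* The argument yields the constant 4, which is below the required 10. *)
  apply: (@le_trans _ _ (4 * enorm HS e z)).
    by apply: (state_bounded_onorm hC e_herm e_unit ge0); apply/enorm_leP.
  by rewrite ler_wpM2r // ler_nat.
- by move=> n x; apply: matricial_statesP.
- by move=> n x; rewrite CobarP // qpolar_CoP.
by move=> n z; apply: qpolar_bar_CobarP.
Qed.
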